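(* Let $\alpha:\mathcal P(E)\to(-\infty,\infty]$ be measurable, bounded from below and not identically $+\infty$, let $\mu\in\mathcal P(E)$, and assume there exists $x_0\in E$ with $\int_Ed^2(x,x_0)\,\mu(\mathrm dx)<\infty$. Let $C>0$. The following are equivalent: (1) $W_2^2(\mu,\nu)\le C\,\alpha(\nu)$ for all $\nu\in\mathcal P(E)$. (2) For each $n\in\mathbb N$, $W_1^2(\mu^{\otimes n},\nu)\le C\,\alpha_n(\nu)$ for all $\nu\in\mathcal P(E^n)$. (2') For each $n\in\mathbb N$, $W_1^2(\mu^{\otimes n},\nu)\le C\,\widehat\alpha_n(\nu)$ for all $\nu\in\mathcal P(E^n)$. (3) For each $n\in\mathbb N$, $\lambda\in\mathbb R$ and bounded $1$-Lipschitz $f:E^n\to\mathbb R$, $\rho_n(\lambda f)\le\lambda\int_{E^n}f\,\mathrm d\mu^{\otimes n}+\frac{C\lambda^2}4$. (3') The same as (3) with $\widehat\rho_n$ in place of $\rho_n$.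
   Context: $(E,d)$ is a complete separable metric space; $\mathcal P(E)$ has the weak topology; $E^n$ carries the $\ell^2$-metric $((x_i),(y_i))\mapsto\sqrt{\sum_i d^2(x_i,y_i)}$, used for Lipschitz constants and Wasserstein distances on $E^n$. $W_p(\nu,\mu)=(\inf_\pi\int d^p\,\mathrm d\pi)^{1/p}$ over couplings $\pi$ (value $+\infty$ allowed). For $\nu\in\mathcal P(E^n)$: $\nu_{-k}:E^{n-1}\to\mathcal P(E)$ is the conditional law of the $k$-th coordinate given the others $x_{-k}=(x_i)_{i\ne k}$ (disintegration); $\nu_{0,1}$ is the first marginal and $\nu_{k-1,k}(x_1,\dots,x_{k-1})$ the conditional law of the $k$-th coordinate given the first $k-1$, so that $\nu(\mathrm dx)=\nu_{0,1}(\mathrm dx_1)\prod_{k=2}^n\nu_{k-1,k}(x_1,\dots,x_{k-1})(\mathrm dx_k)$. Define $\alpha_n(\nu)=\int\sum_{k=1}^n\alpha(\nu_{-k}(x_{-k}))\,\nu(\mathrm dx)$, $\widehat\alpha_n(\nu)=\int\sum_{k=1}^n\alpha(\nu_{k-1,k}(x_1,\dots,x_{k-1}))\,\nu(\mathrm dx)$, and for bounded measurable $f$ on $E^n$, $\rho_n(f)=\sup_{\nu\in\mathcal P(E^n)}(\int f\,\mathrm d\nu-\alpha_n(\nu))$, $\widehat\rho_n(f)=\sup_{\nu\in\mathcal P(E^n)}(\int f\,\mathrm d\nu-\widehat\alpha_n(\nu))$. *)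

(* Defs.v *)
From HB Require Import structures.
From mathcomp Require Import all_boot all_order all_algebra.
From mathcomp Require Import all_classical all_reals all_analysis.
From mathcomp Require Import measurable_realfun.
Set Implicit Arguments. Unset Strict Implicit. Unset Printing Implicit Defensive.
Import Order.TTheory GRing.Theory Num.Theory.
Local Open Scope classical_set_scope.
Local Open Scope ring_scope.

Section Defs.
Variable R : realType.

Definition is_metric {T : Type} (dist : T -> T -> R) : Prop :=
  (forall x y, 0 <= dist x y) /\ (forall x y, dist x y = 0 <-> x = y) /\
  (forall x y, dist x y = dist y x) /\
  (forall x y z, dist x z <= dist x y + dist y z).

Definition metric_complete {T : Type} (dist : T -> T -> R) : Prop :=
  forall u : nat -> T,
    (forall e : R, 0 < e -> exists N, forall m k, (N <= m)%N -> (N <= k)%N ->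
        dist (u m) (u k) < e) ->
    exists l : T, forall e : R, 0 < e -> exists N, forall m, (N <= m)%N ->
        dist (u m) l < e.

Definition metric_separable {T : Type} (dist : T -> T -> R) : Prop :=
  exists u : nat -> T, forall x e, 0 < e -> exists i, dist x (u i) < e.

Definition dopen {T : Type} (dist : T -> T -> R) : set (set T) :=
  [set A | forall x, A x -> exists2 r : R, 0 < r & forall y, dist x y < r -> A y].

Definition Bor {T : pointedType} (dist : T -> T -> R) :=
  g_sigma_algebraType (dopen dist).

Definition dn {E : Type} (d : E -> E -> R) (n : nat) (x y : 'I_n -> E) : R :=
  Num.sqrt (\sum_(i < n) d (x i) (y i) ^+ 2).
Arguments dn {E} d n x y.

Definition BorN {E : pointedType} (d : E -> E -> R) (n : nat) :=
  g_sigma_algebraType (dopen (dn d n)).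

Definition coupling {dd} {T : measurableType dd} (mu nu : probability T R)
  (pi : probability (T * T)%type R) : Prop :=
  (forall A : set T, measurable A -> pi (A `*` setT) = mu A) /\
  (forall B : set T, measurable B -> pi (setT `*` B) = nu B).

Definition Wpow {dd} {T : measurableType dd} (dist : T -> T -> R) (p : nat)
  (mu nu : probability T R) : \bar R :=
  ereal_inf [set (\int[pi]_z ((dist z.1 z.2) ^+ p)%:E)%E
            | pi in [set pi | coupling mu nu pi]].

Definition drop {E : Type} {n : nat} (k : 'I_n) (x : 'I_n -> E) : 'I_n.-1 -> E :=
  fun j => x (lift k j).

Definition ins {E : Type} {n : nat} (k : 'I_n) (x : 'I_n.-1 -> E) (y : E) : 'I_n -> E :=
  fun i => match unlift k i with Some j => x j | None => y end.

Definition firstk {E : Type} {m n : nat} (h : (m <= n)%N) (x : 'I_n -> E) : 'I_m -> E :=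
  fun j => x (widen_ord h j).

Definition snoc {E : Type} {k : nat} (x : 'I_k -> E) (y : E) : 'I_k.+1 -> E :=
  fun j => match unlift ord_max j with Some j' => x j' | None => y end.

Variables (E : pointedType) (d : E -> E -> R).

Definition is_prod_meas (n : nat) (mu : probability (Bor d) R)
  (P : probability (BorN d n) R) : Prop :=
  forall A : 'I_n -> set (Bor d), (forall i, measurable (A i)) ->
    P [set x | forall i, A i (x i)] = (\prod_(i < n) mu (A i))%E.

(** [kap k] is (a version of) the conditional law nu_{-k} of the k-th
    coordinate given the others: a measurable map E^{n-1} -> P(E)
    (P(E) with the sigma-algebra generated by nu |-> nu(A)) such that
    nu(A) = \int kap k (x_{-k}) {y | (x_{-k}, y at k) \in A} nu(dx). *)
Definition cond_others (n : nat) (nu : probability (BorN d n) R)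
  (kap : 'I_n -> BorN d n.-1 -> pprobability (Bor d) R) : Prop :=
  forall k : 'I_n,
    measurable_fun setT (kap k) /\
    forall A : set (BorN d n), measurable A ->
      nu A = (\int[nu]_x ((kap k (drop k x) : probability (Bor d) R)
                            [set y | A (ins k (drop k x) y)]))%E.

(** [kh k] is (a version of) the conditional law nu_{k-1,k} of the
    (k+1)-th coordinate given the first k (0-based k : 'I_n). *)
Definition cond_seq (n : nat) (nu : probability (BorN d n) R)
  (kh : forall k : 'I_n, BorN d k -> pprobability (Bor d) R) : Prop :=
  forall k : 'I_n,
    measurable_fun setT (kh k) /\
    forall B : set (BorN d k.+1), measurable B ->
      nu [set x | B (firstk (ltn_ord k) x)] =
      (\int[nu]_x ((kh k (firstk (ltnW (ltn_ord k)) x) : probability (Bor d) R)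
                     [set y | B (snoc (firstk (ltnW (ltn_ord k)) x) y)]))%E.

Variable alpha : pprobability (Bor d) R -> \bar R.

Definition alpha_n (n : nat) (nu : probability (BorN d n) R)
  (kap : 'I_n -> BorN d n.-1 -> pprobability (Bor d) R) : \bar R :=
  (\int[nu]_x (\sum_(k < n) alpha (kap k (drop k x))))%E.

Definition alphahat_n (n : nat) (nu : probability (BorN d n) R)
  (kh : forall k : 'I_n, BorN d k -> pprobability (Bor d) R) : \bar R :=
  (\int[nu]_x (\sum_(k < n) alpha (kh k (firstk (ltnW (ltn_ord k)) x))))%E.

Definition rho_n (n : nat) (f : BorN d n -> R) : \bar R :=
  ereal_sup [set z | exists nu kap, cond_others nu kap /\
               z = (\int[nu]_x (f x)%:E - alpha_n nu kap)%E].

Definition rhohat_n (n : nat) (f : BorN d n -> R) : \bar R :=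
  ereal_sup [set z | exists nu kh, cond_seq nu kh /\
               z = (\int[nu]_x (f x)%:E - alphahat_n nu kh)%E].

End Defs.

(* Main.v *)
(** Everything rests on two forms of Kantorovich duality.

    Weak duality gives (1) => (3), (3'). Put [g = lambda f] and [P = mu^n], and let
    [G_k y] be the [P]-mean in [x] of the supremum of [g w - sum_(i >= k) d(x_i, w_i)^2 / C]
    over the [w] that agree with [y] on the first [k] coordinates. Integrating the
    [k]-th coordinate of [G_(k+1)] against a law [kappa] costs at most
    [W_2^2(mu, kappa) / C <= alpha(kappa)] above [G_k], by testing with an arbitrary coupling,
    so the inequalities telescope. Finally [G_n = g], and [G_0 <= int g dP + C lambda^2 / 4]
    since [f] is 1-Lipschitz. No optimal coupling has to be selected measurably, and the
    step only uses that redrawing the [k]-th coordinate from its conditional law preserves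
    the law of the first [k+1] coordinates, which holds for both families of conditional laws.

    Strong duality, up to an arbitrarily small error, is obtained by cutting the space into
    finitely many small cells and a remainder of small mass and moment, solving the finite
    transport problem with Farkas' lemma, and spreading each atom of the plan as a
    product of conditioned measures. It gives (3) => (2) after optimising over [lambda].

    For (2) => (1), apply (2) to [nu^n]: some coupling of [mu^n] and [nu^n] has mean distance at
    most about [sqrt (n C alpha(nu))]. If [psi(y) - phi(x) <= d(x, y)^2], the variable
    [Z = (1/n) sum (psi(y_i) - phi(x_i))] satisfies [n Z <= dn(x, y)^2], has mean
    [K = int psi dnu - int phi dmu] and variance [O(1/n)] under every coupling, hence
    [sqrt K <= sqrt (C alpha(nu))] in the limit, and strong duality concludes. *)

Require Import Defs.
From HB Require Import structures.
From mathcomp Require Import all_boot all_order all_algebra.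
From mathcomp Require Import all_classical all_reals all_analysis.
From mathcomp Require Import measurable_realfun.
From mathcomp Require Import ring lra.
Set Implicit Arguments. Unset Strict Implicit. Unset Printing Implicit Defensive.
Import Order.TTheory GRing.Theory Num.Theory.
Import numFieldNormedType.Exports.
Local Open Scope classical_set_scope.
Local Open Scope ring_scope.

(** * Borel structures of separable metric spaces and their powers *)

Lemma bigcup_countType_measurable d (T : measurableType d) (I : countType)
    (F : I -> set T) :
  (forall i, measurable (F i)) -> measurable (\bigcup_i F i).
Proof.
move=> mF.
pose G k : set T := if unpickle k is Some i then F i else set0.
suff -> : \bigcup_i F i = \bigcup_k G k.
  by apply: bigcupT_measurable => k; rewrite /G; case: unpickle.
apply/seteqP; split=> x [i _ Fx].
  by exists (pickle i) => //; rewrite /G pickleK.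
by move: Fx; rewrite /G; case: (unpickle i) => // j Fx; exists j.
Qed.

(** This is how separability yields measurability: [F] will be a countable family of balls,
    rectangles or boxes, and the union of its members inside [U] is countable even when [U] is
    not. *)
Lemma measurable_countable_base d (T : measurableType d) (I : countType)
    (F : I -> set T) (U : set T) :
  (forall i, measurable (F i)) ->
  (forall x, U x -> exists2 i, F i x & F i `<=` U) -> measurable U.
Proof.
move=> mF UF.
pose G i : set T := if `[< F i `<=` U >] then F i else set0.
suff -> : U = \bigcup_i G i.
  by apply: bigcup_countType_measurable => i; rewrite /G; case: ifP.
apply/seteqP; split=> x.
  by move=> /UF[i Fx FU]; exists i => //; rewrite /G; case: asboolP.
by case=> i _; rewrite /G; case: asboolP => // FU /FU.
Qed.

Section PseudoMetric.
Variable R : realType.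

Definition is_pseudometric {T : Type} (dist : T -> T -> R) : Prop :=
  [/\ forall x y, 0 <= dist x y, forall x, dist x x = 0,
      forall x y, dist x y = dist y x &
      forall x y z, dist x z <= dist x y + dist y z].

Lemma metric_pseudometric {T : Type} (dist : T -> T -> R) :
  is_metric dist -> is_pseudometric dist.
Proof. by case=> d0 [deq [dC dt]]; split=> // x; apply/deq. Qed.

Variables (T : pointedType) (dist : T -> T -> R).
Hypothesis distP : is_pseudometric dist.

Let d0 x y : 0 <= dist x y. Proof. by case: distP. Qed.
Let dxx x : dist x x = 0. Proof. by case: distP. Qed.
Let dC x y : dist x y = dist y x. Proof. by case: distP. Qed.
Let dT x y z : dist x z <= dist x y + dist y z. Proof. by case: distP. Qed.

Lemma dopen_measurable (A : set (Bor dist)) : dopen dist A -> measurable A.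
Proof. exact: sub_sigma_algebra. Qed.

(** Right-open rays generate the Borel sets of the line. Semicontinuity is the right generality for
    suprema over uncountable families such as [partial_sup]. *)
Lemma lsc_measurable (f : T -> R) :
  (forall c, dopen dist [set x | c < f x]) ->
  measurable_fun [set: Bor dist] (f : Bor dist -> R).
Proof.
move=> fo; apply: (measurability _ (RGenOInfty.measurableE R)) => _ /= -[_ [r ->] <-].
rewrite setTI; apply: dopen_measurable.
by rewrite (_ : f @^-1` _ = [set x | r < f x])//; apply/seteqP; split=> x /=;
  rewrite in_itv/= andbT.
Qed.

Lemma lipschitz_measurable (f : T -> R) L :
  (forall x y, `|f x - f y| <= L * dist x y) ->
  measurable_fun [set: Bor dist] (f : Bor dist -> R).
Proof.
move=> fL; apply: lsc_measurable => c x /= cfx.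
(* [L] may be zero or negative, so the radius is computed with the positive constant [|L| + 1]. *)
have L1 : 0 < `|L| + 1 by rewrite ltr_wpDl.
exists ((f x - c) / (`|L| + 1)) => [|y xy]; first by rewrite divr_gt0 ?subr_gt0.
move: xy; rewrite ltr_pdivlMr// => xy.
have : f x - f y <= (`|L| + 1) * dist x y.
  rewrite (le_trans (ler_norm _))// (le_trans (fL _ _))// ler_wpM2r//.
  by rewrite (le_trans (ler_norm _))// lerDl.
by lra.
Qed.

Lemma dist_lipschitz x y z : `|dist x z - dist y z| <= dist x y.
Proof.
have := dT y x z; have := dT x y z; rewrite (dC y x) ler_norml => h1 h2.
by apply/andP; split; lra.
Qed.

Lemma measurable_distr z :
  measurable_fun [set: Bor dist] ((dist ^~ z) : Bor dist -> R).
Proof.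
by apply: (@lipschitz_measurable _ 1) => x y; rewrite mul1r; exact: dist_lipschitz.
Qed.

Lemma measurable_dball z r : measurable ([set x | dist x z < r] : set (Bor dist)).
Proof.
rewrite (_ : [set _ | _] = (dist ^~ z) @^-1` `]-oo, r[%classic); last first.
  by apply/seteqP; split => x /=; rewrite in_itv.
by rewrite -[X in measurable X]setTI; apply: measurable_distr.
Qed.

(** Couplings live on the product sigma-algebra, so the sublevel set is covered by countably many
    rectangles: balls of radii [q] and [r - q] about a common dense point. *)
Lemma measurable_dist : metric_separable dist ->
  measurable_fun [set: Bor dist * Bor dist]
    (fun z : Bor dist * Bor dist => dist z.1 z.2).
Proof.
case=> u hu.
apply: (measurability _ (RGenInftyO.measurableE R)) => _ /= -[_ [r ->] <-].
rewrite setTI.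
pose F (t : nat * rat) : set (Bor dist * Bor dist) :=
  [set x | dist x (u t.1) < ratr t.2] `*` [set x | dist x (u t.1) < r - ratr t.2].
apply: (@measurable_countable_base _ _ _ F) => [[i q]|[x y]]/=.
  by apply: measurableX; exact: measurable_dball.
rewrite in_itv/= => xyr.
(* With [q] below a third of the gap, [y] is at distance less than [dist x y] plus a third of the
   gap from [u i], hence less than [r - q]. *)
have e0 : 0 < (r - dist x y) / 3 by rewrite divr_gt0// subr_gt0.
have [i ui] := hu x _ e0.
have [q] := rat_in_itvoo ui; rewrite in_itv/= => /andP[q1 q2].
exists (i, q) => //=; first split => //=.
  by rewrite dC; have := dT (u i) x y; rewrite (dC (u i) x); lra.
case=> x' y' /= [x'q y'q]; rewrite in_itv/=.
rewrite (le_lt_trans (dT x' (u i) y'))// -(subrK (ratr q) r) (dC (u i)) addrC.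
exact: ltrD.
Qed.

End PseudoMetric.

Section ProductMetric.
Variables (R : realType) (E : pointedType) (d : E -> E -> R).
Hypothesis dP : is_pseudometric d.
Variable n : nat.
Let d0 x y : 0 <= d x y. Proof. by case: dP. Qed.
Let dxx x : d x x = 0. Proof. by case: dP. Qed.
Let dC x y : d x y = d y x. Proof. by case: dP. Qed.
Let dT x y z : d x z <= d x y + d y z. Proof. by case: dP. Qed.

Implicit Types x y z w : 'I_n -> E.

(** Cauchy-Schwarz comes from the identity [A (A B - S^2) = sum (A b_i - S a_i)^2]; when [A = 0]
    every [a_i] vanishes. Expanding the squares finishes. *)
Lemma minkowski_sqrt_sum (I : finType) (a b : I -> R) :
  (forall i, 0 <= a i) -> (forall i, 0 <= b i) ->
  Num.sqrt (\sum_i (a i + b i) ^+ 2) <=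
  Num.sqrt (\sum_i a i ^+ 2) + Num.sqrt (\sum_i b i ^+ 2).
Proof.
move=> a0 b0.
set A := \sum_i a i ^+ 2; set B := \sum_i b i ^+ 2.
have A0 : 0 <= A by apply: sumr_ge0 => i _; exact: sqr_ge0.
have B0 : 0 <= B by apply: sumr_ge0 => i _; exact: sqr_ge0.
set S := \sum_i a i * b i.
have SAB : S ^+ 2 <= A * B.
  suff : 0 <= A * (A * B - S ^+ 2).
    have [A1|A1] := ltP 0 A; first by rewrite pmulr_rge0// subr_ge0.
    move=> _; have {}A0 : A = 0 by apply/eqP; rewrite eq_le A1 A0.
    have aE i : a i = 0.
      move/eqP: A0; rewrite psumr_eq0; last by move=> *; exact: sqr_ge0.
      by move=> /allP/(_ i); rewrite mem_index_enum => /(_ isT); rewrite sqrf_eq0 => /eqP.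
    by rewrite A0 mul0r /S big1 ?expr0n// => i _; rewrite aE mul0r.
  have -> : A * (A * B - S ^+ 2) = \sum_i (A * b i - S * a i) ^+ 2.
    under eq_bigr do rewrite sqrrB !exprMn.
    rewrite big_split sumrB/= -!mulr_sumr -/A -/B.
    rewrite (_ : \sum_i _ = 2 * A * S * S); first by ring.
    by rewrite {3}/S mulr_sumr; apply: eq_bigr => i _; ring.
  by apply: sumr_ge0 => i _; exact: sqr_ge0.
rewrite -[leRHS]ger0_norm ?addr_ge0// -sqrtr_sqr ler_wsqrtr//.
rewrite sqrrD !sqr_sqrtr// -sqrtrM//.
have -> : \sum_i (a i + b i) ^+ 2 = A + S *+ 2 + B.
  under eq_bigr do rewrite sqrrD -mulr_natl.
  by rewrite !big_split/= -mulr_sumr mulr_natl.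
rewrite lerD2r lerD2l lerMn2r/=.
rewrite (le_trans (ler_norm _))// -sqrtr_sqr.
by rewrite ler_wsqrtr// mulrC.
Qed.

Lemma dn_pseudometric : is_pseudometric (@dn R E d n).
Proof.
split=> [x y|x|x y|x y z].
- exact: sqrtr_ge0.
- by rewrite /dn big1 ?sqrtr0// => i _; rewrite dxx expr0n.
- by rewrite /dn; under eq_bigr do rewrite dC.
- apply: le_trans (minkowski_sqrt_sum _ _) => //.
  by rewrite ler_wsqrtr// ler_sum// => i _; rewrite lerXn2r// nnegrE ?addr_ge0.
Qed.

Lemma dn_sqr x y : dn d x y ^+ 2 = \sum_i d (x i) (y i) ^+ 2.
Proof. by rewrite sqr_sqrtr// sumr_ge0// => i _; exact: sqr_ge0. Qed.

Lemma dn_ge0 x y : 0 <= dn d x y. Proof. exact: sqrtr_ge0. Qed.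

Lemma d_le_dn x y i : d (x i) (y i) <= dn d x y.
Proof.
rewrite -[leLHS]ger0_norm// -sqrtr_sqr ler_wsqrtr//.
by rewrite (bigD1 i)//= lerDl sumr_ge0// => j _; exact: sqr_ge0.
Qed.

Lemma dn_le_mul x y e : 0 <= e -> (forall i, d (x i) (y i) <= e) ->
  dn d x y <= n%:R * e.
Proof.
move=> e0 xy; rewrite -[leRHS]ger0_norm ?mulr_ge0// -sqrtr_sqr ler_wsqrtr//.
rewrite exprMn (@le_trans _ _ (\sum_(i < n) e ^+ 2))//.
  by rewrite ler_sum// => i _; rewrite lerXn2r// nnegrE.
rewrite sumr_const card_ord -[leLHS]mulr_natl ler_wpM2r ?sqr_ge0//.
by rewrite -natrX ler_nat; case: n => // m; rewrite expnS expn1 leq_pmulr.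
Qed.

Lemma dn_le x y x' y' : (forall i, d (x i) (y i) <= d (x' i) (y' i)) ->
  dn d x y <= dn d x' y'.
Proof.
by move=> h; rewrite ler_wsqrtr// ler_sum// => i _; rewrite lerXn2r// nnegrE.
Qed.

Hypothesis dsep : metric_separable d.

(** Boxes of balls of radius [1/(m+1)] about dense points form a countable base, so the Borel sets
    of the l2-metric are those of the product sigma-algebra. *)
Lemma dopen_box : exists u : nat -> E, forall U, dopen (@dn R E d n) U ->
  forall x, U x -> exists (s : {ffun 'I_n -> nat}) (m : nat),
    (forall i, d (x i) (u (s i)) < m.+1%:R^-1) /\
    [set y | forall i, d (y i) (u (s i)) < m.+1%:R^-1] `<=` U.
Proof.
case: dsep => u hu; exists u => U Uo x Ux.
have [r r0 xr] := Uo x Ux.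
(* Two points of the box differ by less than [2/(m+1)] in each coordinate, hence by at most
   [2n/(m+1) < r] in [dn]. Using [n+1] keeps the quotient meaningful for [n = 0]. *)
have e0 : 0 < r / (2 * n.+1%:R) by rewrite divr_gt0// mulr_gt0.
have [m hm] : exists m, m.+1%:R^-1 < r / (2 * n.+1%:R).
  exists (Num.truncn ((r / (2 * n.+1%:R))^-1)).
  by rewrite invf_plt ?posrE// truncnS_gt// invr_ge0 ltW.
have /choice[s hs] i : exists k, d (x i) (u k) < m.+1%:R^-1 by apply: hu; rewrite invr_gt0.
exists [ffun i => s i], m; split=> [i|y /= ym]; first by rewrite ffunE.
apply: xr.
have D : dn d x y <= n%:R * (2 * m.+1%:R^-1).
  apply: dn_le_mul => [|i]; first by rewrite mulr_ge0// invr_ge0.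
  have := ym i; have := hs i; have := dT (x i) (u (s i)) (y i).
  by rewrite ffunE (dC (u (s i)) (y i)); move: (_^-1) => a; lra.
apply: le_lt_trans D _; move: hm; rewrite ltr_pdivlMr ?mulr_gt0// => hm.
apply: le_lt_trans hm.
by rewrite mulrCA mulrA mulrC ler_wpM2l ?invr_ge0// ler_wpM2l// ler_nat.
Qed.

Lemma measurable_coord i : measurable_fun [set: BorN d n] (fun x : BorN d n => x i : Bor d).
Proof.
apply: (measurability (dopen d : set (set (Bor d)))) => // _ [A Ao <-].
rewrite setTI; apply: (dopen_measurable (T:=('I_n -> E))) => x /= Ax.
have [r r0 h] := Ao _ Ax; exists r => // y xy; apply: h.
exact: le_lt_trans (d_le_dn _ _ _) xy.
Qed.

Lemma measurable_box (A : 'I_n -> set (Bor d)) : (forall i, measurable (A i)) ->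
  measurable ([set x | forall i, A i (x i)] : set (BorN d n)).
Proof.
move=> mA.
rewrite (_ : [set _ | _] = \bigcap_i ((fun x : BorN d n => x i : Bor d) @^-1` A i)).
  apply: fin_bigcap_measurable => // i _; rewrite -[X in measurable X]setTI.
  exact: measurable_coord.
by apply/seteqP; split => x /= h i; [move=> _|]; exact: h.
Qed.

Lemma measurable_fun_BorN dX (X : measurableType dX) (f : X -> BorN d n) :
  (forall i, measurable_fun [set: X] (fun t => f t i : Bor d)) ->
  measurable_fun [set: X] f.
Proof.
move=> mf; apply: (measurability (dopen (@dn R E d n) : set (set (BorN d n)))) => // _ [A Ao <-].
have [u hu] := dopen_box.
rewrite setTI.
pose F (p : {ffun 'I_n -> nat} * nat) : set X :=
  [set t | forall i, d (f t i) (u (p.1 i)) < p.2.+1%:R^-1].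
apply: (@measurable_countable_base _ _ _ F) => [[s m]|x Ax].
  rewrite (_ : F _ = \bigcap_i
    ((fun t => f t i : Bor d) @^-1` [set y | d y (u (s i)) < m.+1%:R^-1])).
    apply: fin_bigcap_measurable => // i _; rewrite -[X in measurable X]setTI.
    by apply: mf => //; exact: measurable_dball.
  by apply/seteqP; split => x /= h i; [move=> _|]; exact: h.
have [s [m [h1 h2]]] := hu _ Ao _ Ax.
by exists (s, m) => // y hy; exact: h2.
Qed.

Lemma dn_separable : metric_separable (@dn R E d n).
Proof.
case: dsep => u hu.
exists (fun k => if unpickle k is Some s then (fun i => u ((s : {ffun 'I_n -> nat}) i)) else point).
move=> x e e0.
have e1 : 0 < e / n.+1%:R by rewrite divr_gt0.
have /choice[s hs] i : exists k, d (x i) (u k) < e / n.+1%:R by exact: hu.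
exists (pickle [ffun i => s i]); rewrite pickleK.
have D : dn d x (fun i => u ([ffun i => s i] i)) <= n%:R * (e / n.+1%:R).
  by apply: dn_le_mul => [|i]; [exact: ltW|rewrite ffunE ltW].
apply: le_lt_trans D _; rewrite mulrCA gtr_pMr// ltr_pdivrMr// mul1r ltr_nat//.
Qed.

(** Boxes are stable under intersection and, by [dopen_box], generate the Borel sets, so the
    uniqueness theorem for finite measures applies. *)
Lemma probability_box_unique (P Q : probability (BorN d n) R) :
  (forall A : 'I_n -> set (Bor d), (forall i, measurable (A i)) ->
    P [set x | forall i, A i (x i)] = Q [set x | forall i, A i (x i)]) ->
  forall B : set (BorN d n), measurable B -> P B = Q B.
Proof.
move=> PQ B mB.
pose G : set (set (BorN d n)) := [set S | exists2 A : 'I_n -> set (Bor d),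
  (forall i, measurable (A i)) & S = [set x | forall i, A i (x i)]].
have GE : @measurable _ (BorN d n) = <<s G >>.
  apply/seteqP; split; last first.
    apply: smallest_sub; first exact: sigma_algebra_measurable.
    by move=> _ [A mA ->]; exact: measurable_box.
  apply: smallest_sub; first exact: smallest_sigma_algebra.
  move=> U Uo; have [u hu] := dopen_box.
  have -> : <<s G >> = (@measurable _ (g_sigma_algebraType G)) by [].
  pose F (t : {ffun 'I_n -> nat} * nat) : set (g_sigma_algebraType G) :=
    [set x | forall i, d (x i) (u (t.1 i)) < t.2.+1%:R^-1].
  apply: (@measurable_countable_base _ _ _ F) => [[s m]|x Ux].
    apply: sub_sigma_algebra.
    exists (fun i => [set y | d y (u (s i)) < m.+1%:R^-1]) => // i.
    exact: measurable_dball.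
  have [s [m [h1 h2]]] := hu _ Uo _ Ux.
  by exists (s, m) => // y hy; exact: h2.
apply: (measure_unique G (fun=> setT) GE _ _ _ P Q _ _ B mB).
- move=> _ _ [A mA ->] [A' mA' ->]; exists (fun i => A i `&` A' i).
    by move=> i; exact: measurableI.
  by apply/seteqP; split => x /= => [[h h'] i|h]; split=> // i; case: (h i).
- by move=> _; exists (fun=> setT) => //; apply/seteqP; split.
- by apply/seteqP; split=> // x _; exists 0%N.
- by move=> _ [A mA ->]; exact: PQ.
- by move=> k /=; rewrite probability_setT ltry.
Qed.

End ProductMetric.

(** * Farkas' lemma and finite transport *)

Section Farkas.
Variable R : realType.

Definition linear_form (V : lmodType R) (f : V -> R) :=
  forall a x y, f (a *: x + y) = a * f x + f y.

(* Bartl's induction on the number of linear forms: if the last form is needed,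
   some x0 satisfies all other constraints and has A_m x0 = 1, and one projects
   along x0. *)
Lemma farkas_ord (V : lmodType R) m (A : 'I_m -> V -> R) (b : V -> R) :
  (forall i, linear_form (A i)) -> linear_form b ->
  (forall x, (forall i, A i x <= 0) -> b x <= 0) ->
  exists2 l : 'I_m -> R, (forall i, 0 <= l i) &
    forall x, b x = \sum_i l i * A i x.
Proof.
elim: m A b => [|m IH] A b linA linb Ab.
  (* Without constraints the hypothesis applies to both [x] and [-x], so [b] vanishes. *)
  exists (fun=> 0) => // x; rewrite big_ord0; apply/eqP; rewrite eq_le Ab//=; last by case.
  have := Ab (-1 *: x + 0) (fun i => False_ind _ (let: Ordinal _ h := i in Bool.diff_false_true h)).
  by rewrite linb; have := linb 1 0 0; rewrite scaler0 addr0 mul1r; lra.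
have sc f a x : linear_form f -> f (a *: x : V) = a * f x.
  move=> linf; have := linf 1 0 0; have := linf a x 0.
  by rewrite scaler0 !addr0 mul1r => ->; lra.
have sub f x y a : linear_form f -> f (x - a *: y : V) = f x - a * f y.
  by move=> linf; rewrite addrC -scaleNr linf mulNr addrC.
have [h|] := pselect (forall x, (forall i, A (lift ord0 i) x <= 0) -> b x <= 0).
  have [l l0 bE] := IH (fun i => A (lift ord0 i)) b (fun i => linA _) linb h.
  exists (fun i => if unlift ord0 i is Some j then l j else 0) => [i|x].
    by case: unliftP.
  rewrite big_ord_recl unlift_none mul0r add0r bE.
  by apply: eq_bigr => i _; rewrite liftK.
move/existsNP => [x1 /not_implyP[Ax1 /negP]]; rewrite -ltNge => bx1.
have A0x1 : 0 < A ord0 x1.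
  rewrite ltNge; apply/negP => h; move: bx1; rewrite ltNge => /negP; apply.
  by apply: Ab => i; have [j ->|->] := unliftP ord0 i.
pose x0 := (A ord0 x1)^-1 *: x1.
have A0x0 : A ord0 x0 = 1 by rewrite sc// mulVf// gt_eqF.
have Ax0 i : A (lift ord0 i) x0 <= 0.
  by rewrite sc// pmulr_rle0// invr_gt0.
have bx0 : 0 <= b x0 by rewrite sc// mulr_ge0// ?invr_ge0 ltW.
(* These are the forms composed with the projection [x - A_0(x) x0], which lands in the kernel of
   [A ord0]. *)
pose A' i x := A (lift ord0 i) x - A (lift ord0 i) x0 * A ord0 x.
pose b' x := b x - b x0 * A ord0 x.
have linA' i : linear_form (A' i) by move=> a x y; rewrite /A' !linA; ring.
have linb' : linear_form b' by move=> a x y; rewrite /b' !(linA, linb); ring.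
have [x Ax|l l0 bE] := IH A' b' linA' linb'.
  have := Ab (x - A ord0 x *: x0); rewrite sub// mulrC; apply => i.
  rewrite sub//; have [j ->|->] := unliftP ord0 i; last by rewrite A0x0 mulr1 subrr.
  by have := Ax j; rewrite /A' mulrC.
(* The multiplier of the first form collects the terms produced by the projection. It is nonnegative
   since [b x0 >= 0] while the other forms are nonpositive at [x0]. *)
exists (fun i => if unlift ord0 i is Some j then l j else
          b x0 - \sum_i l i * A (lift ord0 i) x0) => [i|x].
  case: unliftP => // _; rewrite subr_ge0 (le_trans _ bx0)// sumr_le0// => j _.
  by rewrite mulr_ge0_le0.
rewrite big_ord_recl unlift_none.
rewrite [X in _ + X](eq_bigr (fun i => l i * A (lift ord0 i) x)); last first.
  by move=> i _; rewrite liftK.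
have := bE x; rewrite /b' => /eqP; rewrite subr_eq => /eqP ->.
have -> : \sum_i l i * A' i x = \sum_i l i * A (lift ord0 i) x -
    (\sum_i l i * A (lift ord0 i) x0) * A ord0 x.
  by rewrite mulr_suml -sumrB; apply: eq_bigr => i _; rewrite /A' mulrBr mulrA.
by ring.
Qed.

Lemma farkas (V : lmodType R) (I : finType) (A : I -> V -> R) (b : V -> R) :
  (forall i, linear_form (A i)) -> linear_form b ->
  (forall x, (forall i, A i x <= 0) -> b x <= 0) ->
  exists2 l : I -> R, (forall i, 0 <= l i) &
    forall x, b x = \sum_i l i * A i x.
Proof.
move=> linA linb Ab.
have [|l l0 bE] := @farkas_ord V #|I| (A \o enum_val) b (fun i => linA _) linb.
  by move=> x Ax; apply: Ab => i; have := Ax (enum_rank i); rewrite /= enum_rankK.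
exists (l \o enum_rank) => [i|x]; first exact: l0.
rewrite bE (reindex enum_rank)/=; first by apply: eq_bigr => i _; rewrite enum_rankK.
by apply: onW_bij; exact: enum_rank_bij.
Qed.

(** Homogenise with a scalar [t]: on triples [(phi, psi, t)] the constraints
    [psi_j - phi_i <= t c_ij] and [t >= 0] imply [sum psi q - sum phi p <= A t]. The Farkas
    multipliers of the first family form the transport plan. *)
Lemma finite_kantorovich_duality (I J : finType) (p : I -> R) (q : J -> R)
    (c : I -> J -> R) (A : R) :
  (forall i, 0 <= p i) -> (forall j, 0 <= q j) ->
  \sum_i p i = 1 -> \sum_j q j = 1 ->
  (forall phi psi, (forall i j, psi j - phi i <= c i j) ->
    \sum_j psi j * q j - \sum_i phi i * p i <= A) ->
  exists s : I -> J -> R, [/\ forall i j, 0 <= s i j,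
    forall i, \sum_j s i j = p i, forall j, \sum_i s i j = q j &
    \sum_i \sum_j s i j * c i j <= A].
Proof.
move=> p0 q0 p1 q1 H.
pose V : lmodType R := ({ffun I -> R^o} * {ffun J -> R^o} * R^o)%type.
pose F (k : option (I * J)) (v : V) : R :=
  if k is Some (i, j) then v.1.2 j - v.1.1 i - v.2 * c i j else - v.2.
pose b (v : V) : R := \sum_j v.1.2 j * q j - \sum_i v.1.1 i * p i - A * v.2.
have linF k : linear_form (F k).
  move=> a x y; rewrite /F; case: k => [[i j]|]; rewrite /= ?ffunE /= /GRing.scale/=; ring.
have linb : linear_form b.
  move=> a x y; rewrite /b/=.
  under eq_bigr do rewrite !ffunE/= /GRing.scale/= mulrDl -mulrA.
  under [X in _ - X - _ = _]eq_bigr do rewrite !ffunE/= /GRing.scale/= mulrDl -mulrA.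
  by rewrite !big_split/= -!mulr_sumr /GRing.scale/=; ring.
have [v Fv|s s0 bE] := farkas linF linb.
  have t0 : 0 <= v.2 by have := Fv None; rewrite /F oppr_le0.
  have Fij i j : v.1.2 j - v.1.1 i <= v.2 * c i j.
    by have := Fv (Some (i, j)); rewrite /F subr_le0.
  rewrite /b subr_le0.
  (* For [t > 0] divide the potentials by [t]. For [t = 0] every [psi_j] is below every [phi_i], and
     averaging against [p_i q_j] gives the claim. *)
  have [t1|] := ltP 0 v.2; last first.
    move=> t1; have {t0 t1} t0 : v.2 = 0 by apply/eqP; rewrite eq_le t0 t1.
    rewrite t0 mulr0 subr_le0.
    rewrite -[leLHS]mul1r -p1 mulr_suml -[leRHS]mulr1 -q1 mulr_suml.
    apply: ler_sum => i _; rewrite !mulr_sumr; apply: ler_sum => j _.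
    have := Fij i j; rewrite t0 mul0r subr_le0 => h.
    move: h; move: (v.1.2 j : R) (v.1.1 i : R) => u w uw.
    rewrite [leRHS](_ : _ = w * (p i * q j)); last by ring.
    rewrite [leLHS](_ : _ = u * (p i * q j)); last by ring.
    by rewrite ler_wpM2r// mulr_ge0.
  have := H (fun i => v.1.1 i / v.2) (fun j => v.1.2 j / v.2).
  have -> : \sum_j (v.1.2 j / v.2) * q j = (\sum_j v.1.2 j * q j) / v.2.
    by rewrite mulr_suml; apply: eq_bigr => j _; rewrite mulrAC.
  have -> : \sum_i (v.1.1 i / v.2) * p i = (\sum_i v.1.1 i * p i) / v.2.
    by rewrite mulr_suml; apply: eq_bigr => j _; rewrite mulrAC.
  by rewrite -mulrBl ler_pdivrMr//; apply=> i j; rewrite -mulrBl ler_pdivrMr// mulrC.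
exists (fun i j => s (Some (i, j))).
have sumE (v : V) : \sum_k s k * F k v =
    \sum_i \sum_j s (Some (i, j)) * F (Some (i, j)) v + s None * F None v.
  rewrite (bigD1 None)//= addrC; congr (_ + _).
  rewrite pair_big/= (reindex_omap Some id)/=; last by case.
  by apply: eq_big => [[i j]|[i j] _]//=; rewrite eqxx.
have cst_eq (I' : finType) (k : I') (f : I' -> R) : \sum_i (i == k)%:R * f i = f k.
  rewrite (bigD1 k)//= eqxx mul1r big1 ?addr0// => i /negPf ->; exact: mul0r.
split=> // [i|j|].
(* Evaluating the Farkas identity at unit vectors reads off the row sums, then the column sums. *)
- have := bE ((([ffun i' => (i' == i)%:R] : {ffun I -> R^o}), 0, 0) : V).
  rewrite sumE /b /F/= mulr0 subr0 oppr0 mulr0 addr0.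
  rewrite big1 ?sub0r; last by move=> j _; rewrite ffunE mul0r.
  under eq_bigr do rewrite ffunE.
  rewrite cst_eq => /(congr1 -%R); rewrite opprK => ->.
  rewrite (bigD1 i)//= [X in _ + X]big1 ?addr0; last first.
    move=> i' /negPf i'i; rewrite big1// => j _.
    by rewrite !ffunE i'i mul0r !subr0 mulr0.
  by rewrite -sumrN; apply: eq_bigr => j _; rewrite !ffunE eqxx mul0r subr0 sub0r mulrN1 opprK.
- have := bE ((0, ([ffun j' => (j' == j)%:R] : {ffun J -> R^o}), 0) : V).
  rewrite sumE /b /F/= mulr0 subr0 oppr0 mulr0 addr0.
  rewrite [X in _ - X]big1 ?subr0; last by move=> i _; rewrite ffunE mul0r.
  under eq_bigr do rewrite ffunE.
  rewrite cst_eq => ->.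
  rewrite exchange_big/= (bigD1 j)//= [X in _ + X]big1 ?addr0; last first.
    move=> j' /negPf j'j; rewrite big1// => i _.
    by rewrite !ffunE j'j mul0r !subr0 mulr0.
  by apply: eq_bigr => i _; rewrite !ffunE eqxx mul0r !subr0 mulr1.
(* At [t = 1] with zero potentials the cost equals [A] minus the multiplier of [t >= 0], which is
   nonnegative. *)
- have := bE ((0, 0, 1) : V).
  rewrite sumE /b /F/= mulr1 big1 ?sub0r; last by move=> j _; rewrite ffunE mul0r.
  rewrite big1 ?oppr0 ?add0r; last by move=> j _; rewrite ffunE mul0r.
  under eq_bigr do under eq_bigr do rewrite !ffunE mul1r subr0 sub0r mulrN.
  under eq_bigr do rewrite sumrN.
  rewrite sumrN mulrN1 => h; have := s0 None; lra.
Qed.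

End Farkas.

(** * Couplings and means of bounded functions *)

Section Fibers.
Variables (R : realType) (dT : measure_display) (T : measurableType dT).

Lemma measurable_fiber (I : finType) (cl : T -> I) (A : set I) :
  (forall i, measurable (cl @^-1` [set i])) -> measurable (cl @^-1` A).
Proof.
move=> mcl; rewrite (_ : _ @^-1` _ = \bigcup_(i in A) (cl @^-1` [set i])).
  exact: fin_bigcup_measurable.
apply/seteqP; split=> x /=; first by move=> Ax; exists (cl x).
by case=> i Ai /= ->.
Qed.

Lemma measurable_fun_fiber dU (U : measurableType dU) (I : finType)
    (cl : T -> I) (f : I -> U) :
  (forall i, measurable (cl @^-1` [set i])) ->
  measurable_fun [set: T] (f \o cl).
Proof.
by move=> mcl _ B mB; rewrite setTI comp_preimage; exact: measurable_fiber.
Qed.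

Lemma measure_sum_fiber (mu : {measure set T -> \bar R}) (I : finType)
    (cl : T -> I) (A : set T) :
  measurable A -> (forall i, measurable (cl @^-1` [set i])) ->
  mu A = (\sum_i mu (A `&` cl @^-1` [set i]))%E.
Proof.
move=> mA mcl; rewrite fsbig_seq ?index_enum_uniq// -measure_fin_bigcup.
- congr (mu _); apply/seteqP; split=> x /=; last by case=> i _ [].
  by move=> Ax; exists (cl x) => //=; rewrite mem_index_enum.
- exact: finite_finset.
- by move=> i j _ _ [x [[_ /= <-] [_ <-]]].
- by move=> i _; exact: measurableI.
Qed.

End Fibers.

Section MeasureSum.
Variables (R : realType) (dT : measure_display) (T : measurableType dT).

Lemma finite_sum_measure (I : Type) (s : seq I) (m : I -> {measure set T -> \bar R}) :
  exists M : {measure set T -> \bar R}, forall A, M A = (\sum_(i <- s) m i A)%E.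
Proof.
elim: s => [|i s [M ME]].
  by exists mzero => A; rewrite big_nil.
by exists (measure_add (m i) M) => A; rewrite big_cons -ME; exact: measure_addE.
Qed.

(** Normalising divides by one here; the Dirac mass only fills the default argument of
    [mnormalize]. *)
Lemma probability_of_measure (M : {measure set T -> \bar R}) :
  M setT = 1%E -> exists P : probability T R, forall A, P A = M A.
Proof.
move=> M1; exists (mnormalize M (dirac point : probability T R)) => A.
rewrite /= /mnormalize M1 (_ : (1%E == 0%E :> \bar R) = false); last exact/negbTE/onee_neq0.
by rewrite /= invr1 mule1.
Qed.

End MeasureSum.

(** * Couplings with prescribed masses on the cells of a finite partition *)

Section StepCoupling.
Variables (R : realType) (dT : measure_display) (T : measurableType dT).
Variables (mu nu : probability T R) (I : finType) (cl : T -> I).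
Hypothesis mcl : forall i, measurable (cl @^-1` [set i]).

(** The coupling is the sum over cell pairs of [s i j / (p i * q j)] times the product of the
    restrictions of [mu] and [nu] to the two cells. *)
Lemma step_coupling (s : I -> I -> R) :
  (forall i j, 0 <= s i j) ->
  (forall i, (\sum_j s i j)%:E = mu (cl @^-1` [set i])) ->
  (forall j, (\sum_i s i j)%:E = nu (cl @^-1` [set j])) ->
  exists pi : probability (T * T)%type R, coupling mu nu pi /\
    forall i j, pi ((cl @^-1` [set i]) `*` (cl @^-1` [set j])) = (s i j)%:E.
Proof.
move=> s0 sp sq.
pose p i := \sum_j s i j; pose q j := \sum_i s i j.
have p0 i : 0 <= p i by apply: sumr_ge0.
have q0 j : 0 <= q j by apply: sumr_ge0.
have w0 (ij : I * I) : 0 <= s ij.1 ij.2 / (p ij.1 * q ij.2).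
  by rewrite divr_ge0// mulr_ge0.
have mX (ij : I * I) : measurable ((cl @^-1` [set ij.1]) `*` (cl @^-1` [set ij.2])).
  exact: measurableX.
have [M ME] := finite_sum_measure (index_enum _)
  (fun ij => mscale (NngNum (w0 ij)) (mrestr (mu \x nu)%E (mX ij))).
pose w i j := s i j / (p i * q j).
have MX A B : measurable A -> measurable B -> M (A `*` B) =
    (\sum_i \sum_j (w i j)%:E * (mu (A `&` cl @^-1` [set i]) * nu (B `&` cl @^-1` [set j])))%E.
  move=> mA mB; rewrite ME pair_big/=; apply: eq_bigr => -[i j] _ /=.
  rewrite /mscale/= /mrestr -setXI.
  by congr (_ * _)%E; apply: product_measure1E; exact: measurableI.
(* Null cells cause no harm: the inverse of zero is zero, and [s i j] vanishes as soon as [p i] or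
   [q j] does. *)
have wq i j : w i j * q j = if p i == 0 then 0 else s i j / p i.
  rewrite /w; have [->|pi0] := eqVneq (p i) 0; first by rewrite mul0r invr0 mulr0 mul0r.
  have [qj|qj] := eqVneq (q j) 0; last by field; rewrite qj pi0.
  rewrite qj mulr0.
  suff -> : s i j = 0 by rewrite mul0r.
  apply/eqP; rewrite eq_le s0 andbT -[leRHS]qj /q (bigD1 i)//= lerDl.
  exact: sumr_ge0.
have wp i j : w i j * p i = if q j == 0 then 0 else s i j / q j.
  rewrite /w; have [->|qj0] := eqVneq (q j) 0; first by rewrite mulr0 invr0 mulr0 mul0r.
  have [pi|pi] := eqVneq (p i) 0; last by field; rewrite pi qj0.
  rewrite pi mulr0.
  suff -> : s i j = 0 by rewrite mul0r.
  apply/eqP; rewrite eq_le s0 andbT -[leRHS]pi /p (bigD1 j)//= lerDl.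
  exact: sumr_ge0.
have fin_mu (m : probability T R) A : measurable A -> exists2 r : R, m A = r%:E & 0 <= r.
  move=> mA; exists (fine (m A)); last by rewrite fine_ge0.
  by rewrite fineK// fin_num_measure.
have M1 A : measurable A -> M (A `*` setT) = mu A.
  move=> mA; rewrite MX//= (measure_sum_fiber mu mA mcl).
  apply: eq_bigr => i _; have [r rE r0] := fin_mu mu _ (measurableI _ _ mA (mcl i)).
  have E j : ((w i j)%:E * (mu (A `&` cl @^-1` [set i]) *
      nu ([set: T] `&` cl @^-1` [set j])) = (r * (w i j * q j))%:E)%E.
    rewrite setTI -sq rE.
    transitivity (w i j * (r * q j))%:E; first by [].
    by rewrite mulrCA.
  rewrite (eq_bigr _ (fun j _ => E j)) sumEFin -mulr_sumr [RHS]rE; congr EFin.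
  rewrite (eq_bigr _ (fun j _ => wq i j)).
  have [pi0|pi0] := eqVneq (p i) 0; last by rewrite -mulr_suml divff// mulr1.
  rewrite big1 ?mulr0//; apply/esym/eqP; rewrite eq_le r0 andbT.
  by rewrite -lee_fin -rE -pi0 sp le_measure// inE//; exact: measurableI.
have M2 B : measurable B -> M (setT `*` B) = nu B.
  move=> mB; rewrite MX//= exchange_big/= (measure_sum_fiber nu mB mcl).
  apply: eq_bigr => j _; have [r rE r0] := fin_mu nu _ (measurableI _ _ mB (mcl j)).
  have E i : ((w i j)%:E * (mu ([set: T] `&` cl @^-1` [set i]) *
      nu (B `&` cl @^-1` [set j])) = (r * (w i j * p i))%:E)%E.
    rewrite setTI -sp rE.
    transitivity (w i j * (p i * r))%:E; first by [].
    by rewrite mulrA mulrC.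
  rewrite (eq_bigr _ (fun i _ => E i)) sumEFin -mulr_sumr [RHS]rE; congr EFin.
  rewrite (eq_bigr _ (fun i _ => wp i j)).
  have [qj0|qj0] := eqVneq (q j) 0; last by rewrite -mulr_suml divff// mulr1.
  rewrite big1 ?mulr0//; apply/esym/eqP; rewrite eq_le r0 andbT.
  by rewrite -lee_fin -rE -qj0 sq le_measure// inE//; exact: measurableI.
have [|pi piE] := @probability_of_measure _ _ _ M.
  by rewrite -setXTT M1// probability_setT.
exists pi; split; first by split => A mA; rewrite piE; [exact: M1|exact: M2].
move=> i j; rewrite piE MX// (bigD1 i)//= [X in (_ + X)%E]big1 ?adde0; last first.
  move=> i' /negPf i'i; rewrite big1// => j' _.
  rewrite (_ : _ `&` _ = set0) ?measure0 ?mul0e ?mule0//.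
  by apply/seteqP; split => x //= [->] /eqP; rewrite eq_sym i'i.
rewrite (bigD1 j)//= big1 ?adde0; last first.
  move=> j' /negPf j'j; rewrite [X in nu X](_ : _ = set0) ?measure0 ?mule0//.
  by apply/seteqP; split => x //= [->] /eqP; rewrite eq_sym j'j.
rewrite !setIid -sp -sq -!EFinM mulrA wp; congr EFin.
have [qj0|qj0] := eqVneq (q j) 0; last by rewrite divfK.
apply/esym/eqP; rewrite mul0r eq_le s0 andbT -[leRHS]qj0 /q (bigD1 i)//= lerDl.
exact: sumr_ge0.
Qed.

End StepCoupling.

(** * Real-valued means of bounded measurable functions *)

Section BoundedMeasurable.
Variables (R : realType) (dT : measure_display) (T : measurableType dT).
Implicit Types (f g : T -> R) (P : probability T R).

Definition bounded_measurable f :=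
  measurable_fun [set: T] f /\ exists M, forall x, `|f x| <= M.

Lemma bounded_measurable_integrable P f : bounded_measurable f ->
  P.-integrable setT (EFin \o f).
Proof.
move=> [mf [M fM]]; apply: measurable_bounded_integrable => //.
  by rewrite /= probability_setT ltry.
exists M; split; first exact: num_real.
by move=> r Mr x _ /=; exact: le_trans (fM x) (ltW Mr).
Qed.

Lemma bounded_measurable_cst r : bounded_measurable (cst r).
Proof. by split=> //; exists `|r| => x. Qed.

Lemma bounded_measurableD f g : bounded_measurable f -> bounded_measurable g ->
  bounded_measurable (fun x => f x + g x).
Proof.
move=> [mf [M fM]] [mg [N gN]]; split; first exact: measurable_funD.
by exists (M + N) => x; rewrite (le_trans (ler_normD _ _))// lerD.
Qed.

Lemma bounded_measurableM f g : bounded_measurable f -> bounded_measurable g ->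
  bounded_measurable (fun x => f x * g x).
Proof.
move=> [mf [M fM]] [mg [N gN]]; split; first exact: measurable_funM.
by exists (M * N) => x; rewrite normrM ler_pM.
Qed.

Lemma bounded_measurableZ r f : bounded_measurable f ->
  bounded_measurable (fun x => r * f x).
Proof. by apply: bounded_measurableM; exact: bounded_measurable_cst. Qed.

Lemma bounded_measurableB f g : bounded_measurable f -> bounded_measurable g ->
  bounded_measurable (fun x => f x - g x).
Proof.
move=> bf bg; apply: bounded_measurableD => //.
by have := bounded_measurableZ (-1) bg; under eq_fun do rewrite mulN1r.
Qed.

Lemma bounded_measurable_sum (I : Type) (s : seq I) (f : I -> T -> R) :
  (forall i, bounded_measurable (f i)) ->
  bounded_measurable (fun x => \sum_(i <- s) f i x).
Proof.
move=> bf; elim: s => [|i s IH].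
  by under eq_fun do rewrite big_nil; exact: bounded_measurable_cst.
by under eq_fun do rewrite big_cons; exact: bounded_measurableD.
Qed.

Definition mean P f : R := \int[P]_x f x.

Lemma EFin_mean P f : bounded_measurable f ->
  (mean P f)%:E = (\int[P]_x (f x)%:E)%E.
Proof.
move=> bf; rewrite /mean /Rintegral fineK//.
exact: integrable_fin_num (bounded_measurable_integrable P bf).
Qed.

Lemma mean_cst P r : mean P (fun=> r) = r.
Proof. by rewrite /mean Rintegral_cst//= probability_setT mulr1. Qed.

Lemma le_mean P f g : bounded_measurable f -> bounded_measurable g ->
  (forall x, f x <= g x) -> mean P f <= mean P g.
Proof.
by move=> bf bg fg; apply: le_Rintegral => //; exact: bounded_measurable_integrable.
Qed.

Lemma meanD P f g : bounded_measurable f -> bounded_measurable g ->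
  mean P (fun x => f x + g x) = mean P f + mean P g.
Proof.
by move=> bf bg; apply: RintegralD => //; exact: bounded_measurable_integrable.
Qed.

Lemma meanB P f g : bounded_measurable f -> bounded_measurable g ->
  mean P (fun x => f x - g x) = mean P f - mean P g.
Proof.
by move=> bf bg; apply: RintegralB => //; exact: bounded_measurable_integrable.
Qed.

Lemma meanZ P r f : bounded_measurable f -> mean P (fun x => r * f x) = r * mean P f.
Proof.
by move=> bf; apply: RintegralZl => //; exact: bounded_measurable_integrable.
Qed.

Lemma mean_sum P (I : Type) (s : seq I) (f : I -> T -> R) :
  (forall i, bounded_measurable (f i)) ->
  mean P (fun x => \sum_(i <- s) f i x) = \sum_(i <- s) mean P (f i).
Proof.
move=> bf; elim: s => [|i s IH].
  by under [in LHS]eq_fun do rewrite big_nil; rewrite mean_cst big_nil.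
under [in LHS]eq_fun do rewrite big_cons.
by rewrite meanD// ?IH ?big_cons//; exact: bounded_measurable_sum.
Qed.

Lemma mean_le_cst P f M : bounded_measurable f -> (forall x, f x <= M) -> mean P f <= M.
Proof.
by move=> bf fM; rewrite -[leRHS](mean_cst P); apply: le_mean => //;
  exact: bounded_measurable_cst.
Qed.

Lemma norm_mean P f M : bounded_measurable f -> (forall x, `|f x| <= M) -> `|mean P f| <= M.
Proof.
move=> bf fM; rewrite ler_norml; apply/andP; split; last first.
  by apply: mean_le_cst => // x; exact: le_trans (ler_norm _) (fM x).
rewrite -[leLHS](mean_cst P); apply: le_mean => //; first exact: bounded_measurable_cst.
by move=> x; have := fM x; rewrite ler_norml => /andP[].
Qed.

(** [h] may take infinite values and have either sign, so positive and negative parts are compared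
    separately instead of subtracting integrals. *)
Lemma integral_ge_mean P f (h : T -> \bar R) : bounded_measurable f ->
  measurable_fun [set: T] h -> (forall x, (f x)%:E <= h x)%E ->
  ((mean P f)%:E <= \int[P]_x h x)%E.
Proof.
move=> bf mh fh; rewrite EFin_mean// [leLHS]integralE [leRHS]integralE.
have mf : measurable_fun setT (EFin \o f) by apply/measurable_EFinP; case: bf.
apply: leeB; apply: ge0_le_integral => //.
- exact: measurable_funepos.
- exact: measurable_funepos.
- by move=> x _; rewrite !funeposE ge_max !le_max fh lexx orbT.
- exact: measurable_funeneg.
- exact: measurable_funeneg.
- by move=> x _; rewrite !funenegE ge_max !le_max leeN2 fh lexx orbT.
Qed.

End BoundedMeasurable.

Lemma bounded_measurable_comp (R : realType) d1 d2 (T1 : measurableType d1)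
    (T2 : measurableType d2) (f : T2 -> R) (g : T1 -> T2) :
  measurable_fun [set: T1] g -> bounded_measurable f -> bounded_measurable (fun x => f (g x)).
Proof.
move=> mg [mf [M fM]]; split; first exact: measurableT_comp.
by exists M => x.
Qed.

Lemma eq_mean_image (R : realType) d1 d2 (T1 : measurableType d1)
    (T2 : measurableType d2) (P : probability T1 R) (Q : probability T2 R) (g : T1 -> T2)
    (f : T2 -> R) :
  measurable_fun [set: T1] g -> (forall B, measurable B -> P (g @^-1` B) = Q B) ->
  bounded_measurable f -> mean Q f = mean P (fun x => f (g x)).
Proof.
move=> mg PQ bf; have mf : measurable_fun setT (EFin \o f) by apply/measurable_EFinP; case: bf.
congr fine; rewrite (@eq_measure_integral _ _ _ setT (pushforward P g)); last first.
  by move=> A mA _; exact/esym/PQ.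
rewrite integral_pushforward ?preimage_setT//.
exact: bounded_measurable_integrable (bounded_measurable_comp mg bf).
Qed.

Lemma eq_ge0_integral_image (R : realType) d1 d2 (T1 : measurableType d1)
    (T2 : measurableType d2) (P : probability T1 R) (Q : probability T2 R) (g : T1 -> T2)
    (f : T2 -> \bar R) :
  measurable_fun [set: T1] g -> (forall B, measurable B -> P (g @^-1` B) = Q B) ->
  (forall x, 0 <= f x)%E -> measurable_fun setT f ->
  (\int[Q]_x f x = \int[P]_x f (g x))%E.
Proof.
move=> mg PQ f0 mf; rewrite (@eq_measure_integral _ _ _ setT (pushforward P g)); last first.
  by move=> A mA _; exact/esym/PQ.
by rewrite ge0_integral_pushforward ?preimage_setT//; move=> x _.
Qed.

Section Coupling.
Variables (R : realType) (dT : measure_display) (T : measurableType dT).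
Variables (mu nu : probability T R) (pi : probability (T * T)%type R).
Hypothesis cpi : coupling mu nu pi.

Lemma coupling_fst A : measurable A -> pi (fst @^-1` A) = mu A.
Proof. by move=> mA; rewrite -(proj1 cpi)//; congr (pi _); apply/seteqP; split=> x //= []. Qed.

Lemma coupling_snd A : measurable A -> pi (snd @^-1` A) = nu A.
Proof. by move=> mA; rewrite -(proj2 cpi)//; congr (pi _); apply/seteqP; split=> x //= []. Qed.

Lemma mean_coupling_fst f : bounded_measurable f -> mean pi (fun z => f z.1) = mean mu f.
Proof. by move=> bf; rewrite -(eq_mean_image measurable_fst coupling_fst). Qed.

Lemma mean_coupling_snd f : bounded_measurable f -> mean pi (fun z => f z.2) = mean nu f.
Proof. by move=> bf; rewrite -(eq_mean_image measurable_snd coupling_snd). Qed.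

Lemma integral_coupling_fst f : (forall x, 0 <= f x)%E -> measurable_fun setT f ->
  (\int[pi]_z f z.1 = \int[mu]_x f x)%E.
Proof. by move=> f0 mf; rewrite -(eq_ge0_integral_image measurable_fst coupling_fst). Qed.

Lemma integral_coupling_snd f : (forall x, 0 <= f x)%E -> measurable_fun setT f ->
  (\int[pi]_z f z.2 = \int[nu]_x f x)%E.
Proof. by move=> f0 mf; rewrite -(eq_ge0_integral_image measurable_snd coupling_snd). Qed.

End Coupling.

(** * Power inequalities and vanishing tails *)

Section Powers.
Variable R : realType.
Implicit Types a b B e : R.

(** The sum is at most twice the larger term. *)
Lemma exprD_le a b p : 0 <= a -> 0 <= b -> (a + b) ^+ p <= 2 ^+ p * (a ^+ p + b ^+ p).
Proof.
move=> a0 b0; wlog ab : a b a0 b0 / a <= b => [h|].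
  by have /orP[ab|ba] := le_total a b; [|rewrite addrC [X in _ * X]addrC]; exact: h.
apply: (@le_trans _ _ ((2 * b) ^+ p)).
  by rewrite lerXn2r ?nnegrE ?addr_ge0 ?mulr_ge0// mulr_natl mulr2n lerD2r.
by rewrite exprMn ler_wpM2l ?exprn_ge0// lerDr exprn_ge0.
Qed.

(** A mean value estimate by induction on [p]; [1 <= B] lets [B ^+ p] stand in for the sharper
    [B ^+ p.-1]. It measures the cost of replacing points by cell centres. *)
Lemma expr_perturb a b B e p : 0 <= a -> a <= B -> 0 <= b -> b <= B -> 1 <= B ->
  0 <= e -> a <= b + e -> a ^+ p <= b ^+ p + p%:R * B ^+ p * e.
Proof.
move=> a0 aB b0 bB B1 e0 abe; have B0 : 0 <= B by exact: le_trans B1.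
elim: p => [|p IH]; first by rewrite !expr0 !mul0r addr0.
rewrite exprS; apply: (le_trans (ler_wpM2l a0 IH)); rewrite mulrDr.
have h1 : a * b ^+ p <= b ^+ p.+1 + B ^+ p.+1 * e.
  apply: (@le_trans _ _ ((b + e) * b ^+ p)); first by rewrite ler_wpM2r// exprn_ge0.
  rewrite mulrDl -exprS lerD2l mulrC ler_wpM2r//.
  apply: (@le_trans _ _ (B ^+ p)); first by rewrite lerXn2r// nnegrE.
  by rewrite exprS ler_peMl// exprn_ge0.
have h2 : a * (p%:R * B ^+ p * e) <= p%:R * B ^+ p.+1 * e.
  rewrite [leRHS](_ : _ = B * (p%:R * B ^+ p * e)); last by rewrite exprS; ring.
  by rewrite ler_wpM2r// !mulr_ge0// exprn_ge0.
by rewrite -natr1 !mulrDl mul1r; lra.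
Qed.

End Powers.

Section Tails.
Variables (R : realType) (dT : measure_display) (T : measurableType dT).
Variable P : probability T R.

Lemma mean_fiber (I : finType) (cl : T -> I) (f : I -> R) :
  (forall i, measurable (cl @^-1` [set i])) ->
  mean P (fun x => f (cl x)) = \sum_i f i * fine (P (cl @^-1` [set i])).
Proof.
move=> mcl.
have mind i : bounded_measurable (\1_(cl @^-1` [set i]) : T -> R).
  split; first exact: measurable_indic.
  by exists 1 => x; rewrite indicE; case: (_ \in _); rewrite ?normr1 ?normr0.
rewrite (_ : (fun x => _) = fun x => \sum_i f i * \1_(cl @^-1` [set i]) x).
  rewrite mean_sum; last by move=> i; exact: bounded_measurableZ.
  apply: eq_bigr => i _; rewrite meanZ//; congr (_ * fine _).
  by rewrite integral_indic// setIT.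
apply/funext => x; rewrite (bigD1 (cl x))//= big1 ?addr0.
  by rewrite indicE mem_set// mulr1.
by move=> i icl; rewrite indicE memNset ?mulr0// => /= /eqP; rewrite eq_sym (negPf icl).
Qed.

Lemma measurable_tail (a h : T -> R) (r : R) :
  measurable_fun [set: T] a -> measurable_fun [set: T] h ->
  measurable_fun [set: T] (fun x => (a x * (r <= h x)%R%:R)%:E).
Proof.
move=> ma mh; apply/measurable_EFinP/measurable_funM => //.
rewrite (_ : (fun x => _) = fun x => if (r <= h x)%R then 1%R else 0%R).
  by apply: measurable_fun_ifT => //; exact: measurable_fun_ler.
by apply/funext => x; case: ifP.
Qed.

Lemma measurable_uncovered (U : nat -> set T) n : (forall i, measurable (U i)) ->
  measurable [set x | forall i, (i < n)%N -> ~ U i x].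
Proof.
move=> mU; rewrite (_ : [set x | _] = \bigcap_(i < n) ~` U i); last first.
  by apply/seteqP; split => x /=.
by apply: fin_bigcap_measurable => [|i _]; [exact: finite_II|exact: measurableC].
Qed.

Lemma integral_tail_cvg0 (a h : T -> R) : (forall x, 0 <= a x) ->
  measurable_fun setT a -> measurable_fun setT h ->
  (\int[P]_x (a x)%:E < +oo)%E ->
  (\int[P]_x (a x * (n%:R <= h x)%R%:R)%:E)%E @[n --> \oo] --> (0 : \bar R)%E.
Proof.
move=> a0 ma mh ia.
have mtail n := measurable_tail n%:R ma mh.
have [||||_ _] := @dominated_convergence _ T R P setT measurableT
  (fun n x => (a x * (n%:R <= h x)%R%:R)%:E) (cst 0%E) (EFin \o a) mtail.
- exact: measurable_cst.
- apply: aeW => x _; apply/cvg_ballP => e e0; near=> n.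
  rewrite leNgt (_ : h x < n%:R = true); last by near: n; exact: nbhs_infty_gtr.
  by rewrite mulr0; exact: ballxx.
- apply/integrableP; split; first exact/measurable_EFinP.
  by under eq_integral => x _ do rewrite /= ger0_norm//.
- apply: aeW => x n _ /=; rewrite lee_fin ger0_norm ?mulr_ge0//.
  by case: (n%:R <= h x)%R; rewrite ?mulr1 ?mulr0.
by rewrite integral0.
Unshelve. all: by end_near.
Qed.

(** The uncovered sets decrease to the empty set, so continuity from above applies. *)
Lemma measure_uncovered_cvg0 (U : nat -> set T) : (forall i, measurable (U i)) ->
  (forall x, exists i, U i x) ->
  P [set x | forall i, (i < n)%N -> ~ U i x] @[n --> \oo] --> (0 : \bar R)%E.
Proof.
move=> mU cov; pose F n := [set x | forall i, (i < n)%N -> ~ U i x].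
have mF n : measurable (F n) := measurable_uncovered n mU.
have F0 : \bigcap_n F n = set0.
  apply/seteqP; split=> x // h; have [i Ui] := cov x.
  by have := h i.+1 I i (ltnSn i).
rewrite -(measure0 P) -F0; apply: nonincreasing_cvg_mu => //.
- by rewrite ltey_eq fin_num_measure//; exact: mF.
- by rewrite F0.
- move=> m n mn; apply/subsetPset => x h i im; apply: h; exact: leq_trans mn.
Qed.

End Tails.

(** * Strong Kantorovich duality *)

Section Duality.
Variables (R : realType) (T : pointedType) (dist : T -> T -> R).
Hypotheses (distP : is_pseudometric dist) (distS : metric_separable dist).
Variables (p : nat) (x0 : T).

Let d0 x y : 0 <= dist x y. Proof. by case: distP. Qed.
Let dC x y : dist x y = dist y x. Proof. by case: distP. Qed.
Let dT x y z : dist x z <= dist x y + dist y z. Proof. by case: distP. Qed.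

(** An upper bound on the Kantorovich dual value for the cost [dist ^+ p]; the exponents used later
    are 1 and 2. *)
Definition dual_bound (mu nu : probability (Bor dist) R) (A : R) :=
  forall phi psi : Bor dist -> R, bounded_measurable phi -> bounded_measurable psi ->
    (forall x y, psi y - phi x <= dist x y ^+ p) -> mean nu psi - mean mu phi <= A.

Let mom x := dist x x0 ^+ p.

Lemma moment_ge0 x : 0 <= mom x. Proof. by rewrite exprn_ge0. Qed.

Lemma measurable_moment : measurable_fun [set: Bor dist] (mom : Bor dist -> R).
Proof. by apply: measurable_funX; exact: measurable_distr. Qed.

Lemma cost_le_moments x y : dist x y ^+ p <= 2 ^+ p * mom x + 2 ^+ p * mom y.
Proof.
rewrite -mulrDr; apply: le_trans (exprD_le _ _ _) => //.
by rewrite lerXn2r ?nnegrE ?addr_ge0// (dC y).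
Qed.

Lemma bounded_truncation r N : 0 <= r -> 0 <= N ->
  bounded_measurable (fun x : Bor dist => Num.min (r * mom x) N).
Proof.
move=> r0 N0; split.
  by apply: measurable_minr => //; apply: measurable_funM => //; exact: measurable_moment.
exists N => x; rewrite ger0_norm; first by rewrite ge_min lexx orbT.
by rewrite le_min N0 mulr_ge0// moment_ge0.
Qed.

(** Only [mu] is assumed to have a moment. The truncations of [mom / 2^p] for [psi] and of [mom] for
    [phi] are admissible because [mom y / 2^p <= dist x y ^+ p + mom x]; letting the truncation
    level grow transfers the moment to [nu]. *)
Lemma moment_of_dual_bound (mu nu : probability (Bor dist) R) A :
  (\int[mu]_x (mom x)%:E < +oo)%E -> dual_bound mu nu A ->
  (\int[nu]_x (mom x)%:E < +oo)%E.
Proof.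
move=> imu dual.
have i2 : (0 : R) <= (2 ^+ p)^-1 by rewrite invr_ge0 exprn_ge0.
pose f (N : nat) (x : Bor dist) := Num.min ((2 ^+ p)^-1 * mom x) N%:R.
have fb N : bounded_measurable (f N) by exact: bounded_truncation.
pose B := (\int[mu]_x (mom x)%:E)%E.
have key N : (\int[nu]_x (f N x)%:E <= A%:E + B)%E.
  rewrite -EFin_mean//.
  have gb := bounded_truncation ler01 (ler0n R N).
  have : mean nu (f N) - mean mu (fun x => Num.min (1 * mom x) N%:R) <= A.
    apply: dual => // x y; rewrite mul1r /f.
    have h : (2 ^+ p)^-1 * mom y <= dist x y ^+ p + mom x.
      rewrite mulrC ler_pdivrMr ?exprn_gt0// mulrC.
      by have := exprD_le p (d0 x y) (d0 x x0); apply: le_trans;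
        rewrite lerXn2r ?nnegrE ?addr_ge0// (dC x y).
    rewrite lerBlDr minEle [Num.min (mom x) _]minEle.
    have c0 : 0 <= dist x y ^+ p by rewrite exprn_ge0.
    by case: (leP (mom x) N%:R) => h1; case: ifP => h2; lra.
  rewrite lerBlDr => h; apply: (@le_trans _ _
      (A%:E + (mean mu (fun x => Num.min (1 * mom x) N%:R))%:E)%E).
    by rewrite -EFinD lee_fin.
  rewrite leeD2l// EFin_mean//; apply: ge0_le_integral => //.
  - by move=> x _; rewrite lee_fin le_min mul1r moment_ge0 ler0n.
  - by apply/measurable_EFinP; case: gb.
  - by apply/measurable_EFinP; exact: measurable_moment.
  - by move=> x _; rewrite lee_fin ge_min mul1r lexx.
have mf : measurable_fun [set: Bor dist] (fun x : Bor dist => ((2 ^+ p)^-1 * mom x)%:E).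
  by apply/measurable_EFinP/measurable_funM => //; exact: measurable_moment.
have lim : (\int[nu]_x ((2 ^+ p)^-1 * mom x)%:E <= A%:E + B)%E.
  have cv : (\int[nu]_x (f N x)%:E @[N --> \oo] -->
      \int[nu]_x ((2 ^+ p)^-1 * mom x)%:E)%E.
    rewrite (_ : (\int[nu]_x ((2 ^+ p)^-1 * mom x)%:E)%E =
      (\int[nu]_x limn (fun N => (f N x)%:E))%E).
      apply: cvg_monotone_convergence => //.
      - by move=> N; apply/measurable_EFinP; case: (fb N).
      - by move=> N x _; rewrite lee_fin le_min mulr_ge0 ?moment_ge0//= ler0n.
      - by move=> x _ m n mn; rewrite lee_fin le_min !ge_min lexx /= ler_nat (mn : (m <= n)%N) orbT.
    apply: eq_integral => x _; apply/esym/cvg_lim => //.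
    apply: cvg_near_cst; near=> N; rewrite /f minEle ifT//.
    by near: N; exact: nbhs_infty_ger.
  by rewrite -(cvg_lim _ cv)//; apply: lime_le; [apply/cvg_ex; eexists; exact: cv|exact: nearW].
have {lim} : (((2 ^+ p)^-1)%:E * \int[nu]_x (mom x)%:E < +oo)%E.
  rewrite -ge0_integralZl//; last 2 first.
  - by apply/measurable_EFinP; exact: measurable_moment.
  - by move=> x _; rewrite lee_fin moment_ge0.
  by apply: le_lt_trans lim _; rewrite lte_add_pinfty// ltry.
have : (0 <= \int[nu]_x (mom x)%:E)%E by apply: integral_ge0 => x _; rewrite lee_fin moment_ge0.
case: (\int[nu]_x _)%E => [r| |]//= _; first by move=> _; rewrite ltry.
by rewrite gt0_muley// lte_fin invr_gt0 exprn_gt0.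
Unshelve. all: by end_near.
Qed.

End Duality.

Section StrongDuality.
Variables (R : realType) (T : pointedType) (dist : T -> T -> R).
Hypotheses (distP : is_pseudometric dist) (distS : metric_separable dist).
Variables (p : nat) (x0 : T).

Let d0 x y : 0 <= dist x y. Proof. by case: distP. Qed.
Let dC x y : dist x y = dist y x. Proof. by case: distP. Qed.
Let dT x y z : dist x z <= dist x y + dist y z. Proof. by case: distP. Qed.
Let mom x := dist x x0 ^+ p.
Let mom0 x : 0 <= mom x. Proof. by rewrite exprn_ge0. Qed.

Section Cells.
Variables (u : nat -> T) (r N : nat) (e : R).
Hypothesis e0 : 0 <= e.

(* None is the part far from x0 or not covered by the first N balls. *)
Definition cell (x : Bor dist) : option 'I_N :=
  if dist x x0 < r%:R then [pick i : 'I_N | dist x (u i) < e] else None.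

Lemma measurable_cell i : measurable (cell @^-1` [set i]).
Proof.
pose b (x : Bor dist) : bool * {ffun 'I_N -> bool} :=
  (dist x x0 < r%:R, [ffun i : 'I_N => dist x (u i) < e]).
pose g (t : bool * {ffun 'I_N -> bool}) := if t.1 then [pick i : 'I_N | t.2 i] else None.
have -> : cell = g \o b.
  apply/funext => x; rewrite /cell /g /b/=; case: ifP => // _.
  by apply: eq_pick => j; rewrite /= ffunE.
rewrite comp_preimage; apply: measurable_fiber => -[a f].
have mb z s c : measurable ([set x | (dist x z < s) = c] : set (Bor dist)).
  have mB := measurable_dball distP z s.
  case: c => //; rewrite (_ : [set _ | _] = ~` [set x | dist x z < s]).
    exact: measurableC.
  by apply/seteqP; split=> x /=; [move=> ->|move/negP/negbTE].
rewrite (_ : _ @^-1` _ = [set x | (dist x x0 < r%:R) = a] `&`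
    \bigcap_(i in [set: 'I_N]) [set x | (dist x (u i) < e) = f i]).
  by apply: measurableI => //; apply: fin_bigcap_measurable.
apply/seteqP; split=> x /=.
  by move=> [<- <-]; split=> // i0 _ /=; rewrite ffunE.
by move=> [<- h]; congr (_, _); apply/ffunP => j; rewrite ffunE; exact: h.
Qed.

Lemma cell_Some x i : cell x = Some i -> dist x x0 < r%:R /\ dist x (u i) < e.
Proof. by rewrite /cell; case: ifP => // _; case: pickP => // j ? [<-]. Qed.

Lemma cell_None x : cell x = None ->
  r%:R <= dist x x0 \/ forall i, (i < N)%N -> ~ dist x (u i) < e.
Proof.
rewrite /cell; case: ltP => [_|]; last by left.
by case: pickP => // h _; right => i iN; have := h (Ordinal iN) => /= ->.
Qed.

(** A lower bound for the true cost that depends on the cells only: centre distance minus two radii,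
    and zero when a remainder cell is involved. Potentials admissible for it pull back to admissible
    potentials on the space. *)
Definition cell_cost (i j : option 'I_N) : R :=
  if (i, j) is (Some i, Some j) then Num.max 0 (dist (u i) (u j) - 2 * e) ^+ p else 0.

Lemma cell_cost_ge0 i j : 0 <= cell_cost i j.
Proof. by case: i j => [i|] [j|]//=; rewrite exprn_ge0// le_max lexx. Qed.

Lemma cell_cost_le x y : cell_cost (cell x) (cell y) <= dist x y ^+ p.
Proof.
case xi: (cell x) => [i|]; case yj: (cell y) => [j|]/=; rewrite ?exprn_ge0//.
have [_ xu] := cell_Some xi; have [_ yu] := cell_Some yj.
rewrite lerXn2r ?nnegrE ?le_max ?lexx// ge_max d0/=.
have := dT (u i) x (u j); have := dT x y (u j); rewrite (dC (u i) x); lra.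
Qed.

(** The price of the remainder: the moment beyond radius [r], plus [r^p] on the points within [r]
    missed by the first [N] balls. The factor 2 lets a remainder point also pay [2^p r^p] for a
    partner lying in a small cell. *)
Definition cell_error (x : Bor dist) : R :=
  2 * 2 ^+ p * (mom x * (r%:R <= dist x x0)%R%:R) +
  2 * 2 ^+ p * r%:R ^+ p * \1_[set x | forall i, (i < N)%N -> ~ dist x (u i) < e] x.

Lemma cell_error_ge0 x : 0 <= cell_error x.
Proof. by rewrite /cell_error addr_ge0 ?mulr_ge0 ?exprn_ge0// indicE. Qed.

Lemma moment_le_cell_error x : cell x = None ->
  2 ^+ p * mom x + 2 ^+ p * r%:R ^+ p <= cell_error x.
Proof.
move=> xN; rewrite /cell_error.
have p2 : (0 : R) <= 2 ^+ p by rewrite exprn_ge0.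
have [rx|xr] := leP r%:R (dist x x0).
  rewrite mulr1 -[leLHS]addr0 lerD ?mulr_ge0 ?exprn_ge0// ?indicE//.
  rewrite -mulrA mulr_natl mulr2n lerD2l ler_wpM2l//.
  by rewrite lerXn2r// nnegrE.
have [h|h] := cell_None xN; first by move: xr; rewrite ltNge h.
rewrite mulr0 mulr0 add0r indicE mem_set// mulr1 -!mulrA mulr_natl mulr2n lerD2r.
by rewrite ler_wpM2l// lerXn2r ?nnegrE// ltW.
Qed.

(** For two small cells the powers of nearby distances are compared. Otherwise the cell cost is zero
    and the cost is bounded by moments, which the remainder points pay for through
    [moment_le_cell_error]. *)
Lemma cost_le_cell x y : dist x y ^+ p <=
  (cell_cost (cell x) (cell y) + p%:R * (2 * r%:R + 1) ^+ p * (4 * e)) +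
  (cell_error x + cell_error y).
Proof.
have p2 : (0 : R) <= 2 ^+ p by rewrite exprn_ge0.
have eta0 : 0 <= p%:R * (2 * r%:R + 1) ^+ p * (4 * e).
  by rewrite !mulr_ge0// exprn_ge0// addr_ge0// mulr_ge0.
have Small z i : cell z = Some i -> 2 ^+ p * mom z <= 2 ^+ p * r%:R ^+ p.
  move/cell_Some => [zr _].
  by rewrite ler_wpM2l// lerXn2r// ?nnegrE// ltW.
have xy := cost_le_moments distP p x0 x y; rewrite -/(mom x) -/(mom y) in xy.
have m0 : 0 <= 2 ^+ p * r%:R ^+ p :> R by rewrite mulr_ge0// exprn_ge0.
have := cell_error_ge0 x; have := cell_error_ge0 y.
have := @moment_le_cell_error x; have := @moment_le_cell_error y.
have := Small x; have := Small y.
have := mulr_ge0 p2 (mom0 x); have := mulr_ge0 p2 (mom0 y).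
have cc := cell_cost_ge0 (cell x) (cell y).
case xi: (cell x) => [i|]; case yj: (cell y) => [j|]; rewrite xi yj in cc.
- move=> _ _ _ _ _ _ ey ex.
  have [xr xu] := cell_Some xi; have [yr yu] := cell_Some yj.
  apply: (@le_trans _ _ (cell_cost (Some i) (Some j) +
    p%:R * (2 * r%:R + 1) ^+ p * (4 * e))); last first.
    by rewrite lerDl addr_ge0.
  have h1 := dT x x0 y; have h2 := dT (u i) x (u j); have h3 := dT x y (u j).
  have h4 := dT x (u i) y; have h5 := dT (u i) (u j) y.
  rewrite (dC (u i) x) (dC x0 y) (dC (u j) y) in h1 h2 h3 h4 h5.
  have r0 : (0 : R) <= r%:R by [].
  (* Both distances are at most [2r], and adding 1 makes the bound at least 1. The shift is [4e]:
     two radii lost in [cell_cost] and two between points and centres. *)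
  apply: expr_perturb => //.
  + by lra.
  + by rewrite le_max lexx.
  + by rewrite ge_max; apply/andP; split; lra.
  + by lra.
  + by rewrite mulr_ge0.
  + have : dist (u i) (u j) - 2 * e <= Num.max 0 (dist (u i) (u j) - 2 * e).
      by rewrite le_max lexx orbT.
    by lra.
- by move=> _ _ _ /(_ i erefl) h1 /(_ erefl) h2 _ h3 h4; lra.
- by move=> _ _ /(_ j erefl) h1 _ _ /(_ erefl) h2 h3 h4; lra.
- by move=> _ _ _ _ /(_ erefl) h1 /(_ erefl) h2 h3 h4; lra.
Qed.

Variables (mu nu : probability (Bor dist) R) (A : R).
Hypothesis dual : dual_bound p mu nu A.

(** Finite duality is applied to the cell masses with [cell_cost], the resulting plan is spread by
    [step_coupling], and [cost_le_cell] is integrated against it. *)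
Lemma cell_coupling_le : exists2 pi : probability (Bor dist * Bor dist)%type R,
  coupling mu nu pi &
  (\int[pi]_z (dist z.1 z.2 ^+ p)%:E <=
    (A + p%:R * (2 * r%:R + 1) ^+ p * (4 * e))%:E +
    (\int[mu]_x (cell_error x)%:E + \int[nu]_x (cell_error x)%:E))%E.
Proof.
have fiberE (m : probability (Bor dist) R) i :
    m (cell @^-1` [set i]) = (fine (m (cell @^-1` [set i])))%:E.
  by rewrite fineK// fin_num_measure//; exact: measurable_cell.
have fiber1 (m : probability (Bor dist) R) : \sum_i fine (m (cell @^-1` [set i])) = 1.
  have := mean_fiber m (fun=> 1) measurable_cell.
  by rewrite mean_cst => ->; apply: eq_bigr => i _; rewrite mul1r.
have bstep (f : option 'I_N -> R) : bounded_measurable (f \o cell).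
  split; first exact: measurable_fun_fiber measurable_cell.
  exists (\sum_i `|f i|) => x /=; rewrite (bigD1 (cell x))//= lerDl.
  exact: sumr_ge0.
have [|||||s [s0 sp sq sA]] := @finite_kantorovich_duality R _ _
    (fun i => fine (mu (cell @^-1` [set i]))) (fun j => fine (nu (cell @^-1` [set j])))
    cell_cost A.
- by move=> i; rewrite fine_ge0.
- by move=> i; rewrite fine_ge0.
- exact: fiber1.
- exact: fiber1.
- move=> phi psi h.
  rewrite -(mean_fiber mu phi measurable_cell) -(mean_fiber nu psi measurable_cell).
  apply: dual; [exact: bstep|exact: bstep|move=> x y /=].
  exact: le_trans (h _ _) (cell_cost_le x y).
have [i|j|pi [cpi piE]] := @step_coupling _ _ _ mu nu _ cell measurable_cell s s0.
- by rewrite sp [RHS]fiberE.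
- by rewrite sq [RHS]fiberE.
exists pi => //.
pose cl2 (z : Bor dist * Bor dist) := (cell z.1, cell z.2).
pose eta := p%:R * (2 * r%:R + 1) ^+ p * (4 * e).
have eta0 : 0 <= eta by rewrite !mulr_ge0// exprn_ge0// addr_ge0// mulr_ge0.
have mcl2 ij : measurable (cl2 @^-1` [set ij]).
  case: ij => i j; rewrite (_ : _ @^-1` _ = (cell @^-1` [set i]) `*` (cell @^-1` [set j])).
    by apply: measurableX; exact: measurable_cell.
  by apply/seteqP; split => z /= [<- <-].
have merr : measurable_fun [set: Bor dist] cell_error.
  apply: measurable_funD; apply: measurable_funM => //.
    apply/measurable_EFinP; apply: measurable_tail; first exact: measurable_moment.
    exact: measurable_distr.
  by apply/measurable_indic/measurable_uncovered => i; exact: measurable_dball.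
have merr1 : measurable_fun [set: Bor dist] (fun x => (cell_error x)%:E).
  exact/measurable_EFinP.
have b1 : bounded_measurable (fun z : Bor dist * Bor dist => cell_cost (cell z.1) (cell z.2)).
  split; first exact: (measurable_fun_fiber (fun ij => cell_cost ij.1 ij.2) mcl2).
  exists (\sum_ij `|cell_cost ij.1 ij.2|) => z.
  by rewrite (bigD1 (cell z.1, cell z.2))//= lerDl sumr_ge0.
have b2 := bounded_measurableD b1 (bounded_measurable_cst _ eta).
have mean2 : mean pi (fun z => cell_cost (cell z.1) (cell z.2) + eta) <= A + eta.
  rewrite meanD ?mean_cst ?lerD2r//; last exact: bounded_measurable_cst.
  rewrite (mean_fiber pi (fun ij => cell_cost ij.1 ij.2) mcl2).
  apply: le_trans sA; rewrite pair_big/= le_eqVlt; apply/orP; left; apply/eqP.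
  apply: eq_bigr => -[i j] _ /=; rewrite mulrC; congr (_ * _).
  rewrite (_ : _ @^-1` _ = (cell @^-1` [set i]) `*` (cell @^-1` [set j])) ?piE//.
  by apply/seteqP; split => z /= [<- <-].
apply: (@le_trans _ _ (\int[pi]_z ((cell_cost (cell z.1) (cell z.2) + eta)%:E +
    ((cell_error z.1)%:E + (cell_error z.2)%:E)))%E).
  apply: ge0_le_integral => //.
  - by move=> z _; rewrite lee_fin exprn_ge0.
  - by apply/measurable_EFinP/measurable_funX; exact: measurable_dist.
  - apply: emeasurable_funD; first by apply/measurable_EFinP; case: b2.
    by apply: emeasurable_funD; exact: measurableT_comp merr1 _.
  - by move=> z _; rewrite -!EFinD lee_fin; exact: cost_le_cell.
rewrite ge0_integralD//.
- rewrite -(EFin_mean pi b2) leeD ?lee_fin// ge0_integralD//.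
  + by rewrite (integral_coupling_fst cpi (f:=fun x => (cell_error x)%:E))//
       ?(integral_coupling_snd cpi (f:=fun x => (cell_error x)%:E))// => x;
       rewrite lee_fin cell_error_ge0.
  + by move=> z _; rewrite lee_fin cell_error_ge0.
  + exact: measurableT_comp merr1 _.
  + by move=> z _; rewrite lee_fin cell_error_ge0.
  + exact: measurableT_comp merr1 _.
- by move=> z _; rewrite lee_fin addr_ge0// cell_cost_ge0.
- by apply/measurable_EFinP; case: b2.
- by move=> z _; rewrite adde_ge0// lee_fin cell_error_ge0.
- by apply: emeasurable_funD; exact: measurableT_comp merr1 _.
Qed.

End Cells.

(** The parameters are chosen in order: the radius [r] from the tails of both moments, then the mesh
    [e] depending on [r], then the number [N] of balls depending on [e]. Mesh, [mu]-error and
    [nu]-error each cost at most [eps / 4]. *)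
Theorem kantorovich_duality (mu nu : probability (Bor dist) R) A :
  (\int[mu]_x (dist x x0 ^+ p)%:E < +oo)%E -> dual_bound p mu nu A ->
  (Wpow (T := Bor dist) dist p mu nu <= A%:E)%E.
Proof.
move=> imu dual; have inu := moment_of_dual_bound distP imu dual.
case: distS => u hu.
apply/lee_addgt0Pr => eps eps0.
have K0 : 0 < 2 * 2 ^+ p :> R by rewrite mulr_gt0// exprn_gt0.
have e8 : 0 < eps / 8 by rewrite divr_gt0.
have mmom : measurable_fun [set: Bor dist] (mom : Bor dist -> R) := measurable_moment distP p x0.
have small (K : R) (f : nat -> \bar R) : 0 < K -> f n @[n --> \oo] --> (0 : \bar R)%E ->
    \forall n \near \oo, (K%:E * f n <= (eps / 8)%:E)%E.
  move=> {}K0 f0; have e1 : (0 < (K^-1)%:E * (eps / 8)%:E)%E.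
    by rewrite -EFinM lte_fin mulr_gt0// invr_gt0.
  have h : \forall n \near \oo, (f n < (K^-1)%:E * (eps / 8)%:E)%E.
    exact: (f0 _ (open_nbhs_nbhs (conj (@open_ereal_lt_ereal _ _) e1))).
  near=> n; have : (f n < (K^-1)%:E * (eps / 8)%:E)%E by near: n.
  by rewrite lte_pdivlMl// => /ltW.
pose tl (m : probability (Bor dist) R) (r : nat) :=
  (\int[m]_x (mom x * (r%:R <= dist x x0)%R%:R)%:E)%E.
have [r [rmu rnu]] : exists r, ((2 * 2 ^+ p)%:E * tl mu r <= (eps / 8)%:E)%E /\
    ((2 * 2 ^+ p)%:E * tl nu r <= (eps / 8)%:E)%E.
  have tmu := small _ _ K0 (@integral_tail_cvg0 _ _ _ mu mom (dist ^~ x0) mom0 mmom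
    (measurable_distr distP x0) imu).
  have tnu := small _ _ K0 (@integral_tail_cvg0 _ _ _ nu mom (dist ^~ x0) mom0 mmom
    (measurable_distr distP x0) inu).
  by have [r _ /(_ r (leqnn _))] := filterI tmu tnu; exists r.
(* The denominator is the coefficient of [e] in the mesh error; the added 1 keeps it positive when
   [p = 0]. *)
pose e := eps / 4 / (p%:R * (2 * r%:R + 1) ^+ p * 4 + 1).
have De : 0 < p%:R * (2 * r%:R + 1) ^+ p * 4 + 1 :> R.
  by rewrite ltr_wpDl// !mulr_ge0// exprn_ge0// addr_ge0// mulr_ge0.
have e0 : 0 < e by rewrite divr_gt0// divr_gt0.
pose unc N : set (Bor dist) := [set x | forall i, (i < N)%N -> ~ dist x (u i) < e].
pose L : R := 2 * 2 ^+ p * r%:R ^+ p.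
have L0 : 0 <= L by rewrite mulr_ge0 ?exprn_ge0// ltW.
have [N [Nmu Nnu]] : exists N, (L%:E * mu (unc N) <= (eps / 8)%:E)%E /\
    (L%:E * nu (unc N) <= (eps / 8)%:E)%E.
  have cov (x : Bor dist) : exists i, dist x (u i) < e by exact: hu.
  have mU i : measurable ([set x | dist x (u i) < e] : set (Bor dist)).
    exact: measurable_dball.
  (* [L] can be zero, whereas [small] requires a positive factor. *)
  have L1 : 0 < L + 1 by rewrite ltr_wpDl.
  have tmu := small _ _ L1 (measure_uncovered_cvg0 mu mU cov).
  have tnu := small _ _ L1 (measure_uncovered_cvg0 nu mU cov).
  have [N _ /(_ N (leqnn _))[h1 h2]] := filterI tmu tnu; exists N.
  by split; [apply: le_trans h1|apply: le_trans h2]; rewrite lee_wpmul2r// lee_fin lerDl.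
have merr (m : probability (Bor dist) R) : ((2 * 2 ^+ p)%:E * tl m r <= (eps / 8)%:E)%E ->
    (L%:E * m (unc N) <= (eps / 8)%:E)%E ->
    (\int[m]_x (cell_error u r N e x)%:E <= (eps / 4)%:E)%E.
  move=> h1 h2; rewrite [leRHS](_ : _ = (eps / 8)%:E + (eps / 8)%:E)%E; last first.
    by rewrite -EFinD; congr EFin; lra.
  have munc : measurable (unc N).
    by apply: measurable_uncovered => i; exact: measurable_dball.
  have mt := measurable_tail (a := (mom : Bor dist -> R)) r%:R mmom (measurable_distr distP x0).
  have mi : measurable_fun [set: Bor dist] (fun x => (\1_(unc N) x)%:E : \bar R).
    by apply/measurable_EFinP; exact: measurable_indic.
  have t0 x : (0 <= (mom x * (r%:R <= dist x x0)%R%:R)%:E)%E.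
    by rewrite lee_fin mulr_ge0.
  have i0 x : (0 <= (\1_(unc N) x)%:E :> \bar R)%E by rewrite lee_fin indicE.
  have I1 := @ge0_integralZl _ _ _ m _ measurableT _ mt _ (fun x _ => t0 x)
    (ltW K0 : (0 <= (2 * 2 ^+ p)%:E)%E).
  have I2 := @ge0_integralZl _ _ _ m _ measurableT _ mi _ (fun x _ => i0 x) (L0 : (0 <= L%:E)%E).
  have {I2}I2 : (\int[m]_x (L%:E * (\1_(unc N) x)%:E) = L%:E * m (unc N))%E.
    by rewrite I2 integral_indic// setIT.
  rewrite -/(tl m r) in I1.
  rewrite -I1 in h1; rewrite -I2 in h2.
  rewrite (_ : (\int[m]_x _ = \int[m]_x ((2 * 2 ^+ p)%:E *
     (mom x * (r%:R <= dist x x0)%R%:R)%:E + L%:E * (\1_(unc N) x)%:E))%E)//.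
  rewrite ge0_integralD//; first exact: leeD.
  - by move=> x _; rewrite mule_ge0// lee_fin ltW.
  - exact: measurable_funeM.
  - by move=> x _; rewrite mule_ge0.
  - exact: measurable_funeM.
have [pi cpi piA] := cell_coupling_le u r N (ltW e0) dual.
apply: (@le_trans _ _ (\int[pi]_z (dist z.1 z.2 ^+ p)%:E)%E).
  by apply: ereal_inf_lbound; exists pi.
apply: le_trans piA _.
apply: (@le_trans _ _ ((A + eps / 4)%:E + ((eps / 4)%:E + (eps / 4)%:E))%E).
  apply: leeD; last by apply: leeD; exact: merr.
  rewrite lee_fin lerD2l mulrA /e mulrA ler_pdivrMr// mulrC ler_wpM2l ?lerDl//.
  by rewrite divr_ge0// ltW.
by rewrite -!EFinD lee_fin; lra.
Unshelve. all: by end_near.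
Qed.

End StrongDuality.

(** * Disintegration and product measures *)

Section Disintegration.
Variables (R : realType) (dX dY dZ : measure_display).
Variables (X : measurableType dX) (Y : measurableType dY) (Z : measurableType dZ).
Variables (nu : probability X R) (kap : X -> pprobability Y R) (u : X * Y -> Z).
Hypothesis mkap : measurable_fun [set: X] kap.
Hypothesis mu : measurable_fun [set: X * Y] u.
Variable m : probability Z R.
Hypothesis mE : forall B, measurable B ->
  m B = (\int[nu]_x ((kap x : probability Y R) [set y | B (u (x, y))]))%E.

(** The [unit] factor turns [nu] into a constant kernel, so that [m] becomes a composition of
    kernels: draw [x], then [y] from [kap x], then apply [u]. *)
Let kap' : unit * X -> pprobability Y R := kap \o snd.
Let mkap' : measurable_fun [set: unit * X] kap'.
Proof. by apply: measurableT_comp => //; exact: measurable_snd. Qed.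

Let u' (z : unit * X * Y) : Z := u (z.1.2, z.2).
Let mu' : measurable_fun [set: unit * X * Y] u'.
Proof.
apply: measurableT_comp => //; apply: measurable_fun_pair.
  by apply: measurableT_comp measurable_fst; exact: measurable_snd.
exact: measurable_snd.
Qed.

Let mnu : measurable_fun [set: unit] (cst nu : unit -> pprobability X R).
Proof. exact: measurable_cst. Qed.

Let law : R.-sfker unit * X ~> Z := (kprobability mkap' \; kdirac mu')%E.

Lemma ge0_integral_disintegration (g : Z -> \bar R) :
  (forall z, 0 <= g z)%E -> measurable_fun [set: Z] g ->
  (\int[m]_z g z = \int[nu]_x \int[kap x : probability Y R]_y g (u (x, y)))%E.
Proof.
move=> g0 mg.
have lawE x B : measurable B -> law (tt, x) B = (kap x : probability Y R) [set y | B (u (x, y))].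
  move=> mB; rewrite /law /= /kcomp /kdirac/=.
  have mS : measurable [set y | B (u (x, y))].
    have -> : [set y | B (u (x, y))] = (fun y => u (x, y)) @^-1` B by [].
    rewrite -[X in measurable X]setTI; apply: (measurableT_comp mu (pair1_measurable x)) => //.
  transitivity (\int[kap x : probability Y R]_y (\1_[set y | B (u (x, y))] y)%:E)%E.
    by apply: eq_integral => y _; rewrite diracE indicE.
  by rewrite integral_indic// setIT.
transitivity (\int[kcomp (kprobability mnu) law tt]_z g z)%E.
  apply: eq_measure_integral => B mB _; apply: etrans (mE mB) _.
  by apply: eq_integral => x _; rewrite -lawE.
rewrite integral_kcomp//.
apply: eq_integral => x _; rewrite /law integral_kcomp//.
apply: eq_integral => y _; rewrite integral_dirac// ?diracT ?mul1e//.
Qed.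

Lemma measurable_disintegration (g : Z -> \bar R) :
  (forall z, 0 <= g z)%E -> measurable_fun [set: Z] g ->
  measurable_fun [set: X] (fun x => \int[kap x : probability Y R]_y g (u (x, y)))%E.
Proof.
move=> g0 mg.
apply: (measurable_fun_integral_finite_kernel (g \o u) (kprobability mkap)) => //.
  by move=> z; exact: g0.
exact: (measurableT_comp mg mu).
Qed.

Lemma bounded_disintegration (g : Z -> R) : bounded_measurable g ->
  bounded_measurable (fun x => mean (kap x) (fun y => g (u (x, y)))) /\
  mean m g = mean nu (fun x => mean (kap x) (fun y => g (u (x, y)))).
Proof.
move=> bg; have [mg [M gM]] := bg.
have bs x : bounded_measurable (fun y => g (u (x, y))).
  apply: bounded_measurable_comp bg.
  by apply: (measurableT_comp mu); exact: pair1_measurable.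
(* Shifting by the bound [M] reduces to the nonnegative case. *)
pose h z := g z + M.
have bh : bounded_measurable h by apply: bounded_measurableD => //; exact: bounded_measurable_cst.
have bhs x : bounded_measurable (fun y => h (u (x, y))).
  by apply: bounded_measurableD => //; exact: bounded_measurable_cst.
have h0 z : (0 <= (h z)%:E)%E.
  by rewrite lee_fin /h -lerBlDr sub0r; have := gM z; rewrite ler_norml => /andP[].
have mh : measurable_fun setT (EFin \o h) by apply/measurable_EFinP; case: bh.
have hE x : mean (kap x) (fun y => g (u (x, y))) = mean (kap x) (fun y => h (u (x, y))) - M.
  by rewrite meanD ?mean_cst ?addrK//; exact: bounded_measurable_cst.
have bmean : bounded_measurable (fun x => mean (kap x) (fun y => g (u (x, y)))).
  split; last first.
    by exists M => x; apply: norm_mean.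
  under eq_fun do rewrite hE.
  apply: measurable_funB => //; apply/measurable_EFinP.
  rewrite (_ : _ \o _ = fun x => (\int[kap x : probability Y R]_y (h (u (x, y)))%:E)%E).
    apply: (@measurable_disintegration (EFin \o h)) => //; by move=> z; exact: h0.
  by apply/funext => x /=; rewrite EFin_mean.
split=> //.
have -> : mean m g = mean m h - M.
  by rewrite meanD ?mean_cst ?addrK//; exact: bounded_measurable_cst.
rewrite (_ : (fun x => mean (kap x) _) =
    fun x => mean (kap x) (fun y => h (u (x, y))) - M); last by apply/funext.
have bmh : bounded_measurable (fun x => mean (kap x) (fun y => h (u (x, y)))).
  have := bounded_measurableD bmean (bounded_measurable_cst _ M).
  by under eq_fun do rewrite hE subrK.
rewrite meanB ?mean_cst//; last exact: bounded_measurable_cst.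
congr (_ - _); apply: EFin_inj; rewrite EFin_mean// ge0_integral_disintegration//.
rewrite EFin_mean//; apply: eq_integral => x _; by rewrite EFin_mean.
Qed.

End Disintegration.

Lemma probability_image (R : realType) d1 d2 (T1 : measurableType d1)
    (T2 : measurableType d2) (P : probability T1 R) (f : T1 -> T2) :
  measurable_fun [set: T1] f ->
  exists Q : probability T2 R, forall B, measurable B -> Q B = P (f @^-1` B).
Proof.
move=> mf; pose f' : {mfun T1 >-> T2} := HB.pack f (isMeasurableFun.Build _ _ _ _ _ mf).
by exists (distribution P f').
Qed.

(** The second slice formula follows from uniqueness of the product measure. The two formulas give
    the two orders of integration used in resampling. *)
Lemma product_probability (R : realType) d1 d2 (T1 : measurableType d1)
    (T2 : measurableType d2) (P : probability T1 R) (Q : probability T2 R) :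
  exists PQ : probability (T1 * T2)%type R,
  [/\ forall A B, measurable A -> measurable B -> PQ (A `*` B) = (P A * Q B)%E,
      forall A, measurable A -> PQ A = (\int[P]_x Q [set y | A (x, y)])%E &
      forall A, measurable A -> PQ A = (\int[Q]_y P [set x | A (x, y)])%E].
Proof.
have [|PQ PQE] := @probability_of_measure R _ _ (P \x Q)%E.
  by rewrite -setXTT; apply: etrans (product_measure1E _ _ _ _) _ => //;
    rewrite /= !probability_setT mule1.
exists PQ; split=> [A B mA mB|A mA|A mA].
- by rewrite PQE; exact: product_measure1E.
- rewrite PQE /= /product_measure1; apply: eq_integral => x _ /=.
  by congr (Q _); apply/seteqP; split => y /=; rewrite /xsection/= in_setE.
- rewrite PQE; transitivity ((P \x^ Q)%E A).
    apply: (@product_measure_unique _ _ _ _ _ P Q (P \x^ Q)%E) => // B1 B2 mB1 mB2.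
    exact: product_measure2E.
  rewrite /= /product_measure2; apply: eq_integral => x _ /=.
  by congr (P _); apply/seteqP; split => y /=; rewrite /ysection/= in_setE.
Qed.

(** * Product measures and resampling of one coordinate *)

Section ProductSpace.
Variables (R : realType) (E : pointedType) (d : E -> E -> R).
Hypotheses (dP : is_pseudometric d) (dsep : metric_separable d).

Definition upd n (k : 'I_n) (x : 'I_n -> E) (y : E) : 'I_n -> E :=
  fun i => if i == k then y else x i.

Lemma ins_drop n (k : 'I_n) (x : 'I_n -> E) y : ins k (Defs.drop k x) y = upd k x y.
Proof.
apply/funext => i; rewrite /ins /Defs.drop /upd.
by case: unliftP => [j ->|->]; rewrite ?eqxx// eq_sym (negPf (neq_lift _ _)).
Qed.

Lemma measurable_upd n (k : 'I_n) :
  measurable_fun [set: BorN d n * Bor d] (fun z => upd k z.1 z.2 : BorN d n).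
Proof.
apply: (measurable_fun_BorN dP dsep) => i; rewrite /upd; case: eqP => _.
  exact: measurable_snd.
exact: (measurableT_comp (measurable_coord dP i) measurable_fst).
Qed.

Lemma measurable_upd_swap n (k : 'I_n) :
  measurable_fun [set: Bor d * BorN d n] (fun z => upd k z.2 z.1 : BorN d n).
Proof.
apply: (measurable_fun_BorN dP dsep) => i; rewrite /upd; case: eqP => _.
  exact: measurable_fst.
exact: (measurableT_comp (measurable_coord dP i) measurable_snd).
Qed.

Lemma measurable_drop n (k : 'I_n) :
  measurable_fun [set: BorN d n] (Defs.drop k : BorN d n -> BorN d n.-1).
Proof. by apply: (measurable_fun_BorN dP dsep) => i; exact: (measurable_coord dP). Qed.

Lemma measurable_firstk m n (h : (m <= n)%N) :
  measurable_fun [set: BorN d n] (firstk h : BorN d n -> BorN d m).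
Proof. by apply: (measurable_fun_BorN dP dsep) => i; exact: (measurable_coord dP). Qed.

Section Resample.
Variables (mu : probability (Bor d) R) (n : nat) (P : probability (BorN d n) R).
Hypothesis prodP : is_prod_meas mu P.
Variable k : 'I_n.

(** It suffices to check boxes: the overwritten coordinate contributes mass one under [P], and the
    fresh draw restores the factor [mu (A k)]. *)
Lemma resample_image (PQ : probability (BorN d n * Bor d)%type R) :
  (forall A B, measurable A -> measurable B -> PQ (A `*` B) = (P A * mu B)%E) ->
  forall B : set (BorN d n), measurable B ->
    PQ ((fun z => upd k z.1 z.2) @^-1` B) = P B.
Proof.
move=> PQE B mB.
have [Q QE] := probability_image PQ (measurable_upd k).
rewrite -QE//; apply: (probability_box_unique dP dsep) => // A mA.
rewrite QE; last exact: measurable_box.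
pose A' i := if i == k then setT else A i.
rewrite (_ : _ @^-1` _ = [set x | forall i, A' i (x i)] `*` A k); last first.
  apply/seteqP; split => -[x y] /=; rewrite /upd => h.
    split; last by have := h k; rewrite eqxx.
    by move=> i; rewrite /A'; case: eqP => // /eqP ik; have := h i; rewrite (negPf ik).
  by case: h => h Ay i; have := h i; rewrite /A'; case: eqP => // ->.
have mA' i : measurable (A' i) by rewrite /A'; case: eqP.
rewrite PQE//; last exact: measurable_box.
rewrite !prodP// (bigD1 k)//= /A' eqxx probability_setT mul1e.
rewrite [RHS](bigD1 k)//= muleC; congr (_ * _)%E.
by apply: eq_bigr => i /negPf ->.
Qed.

Lemma resample_right (B : set (BorN d n)) : measurable B ->
  P B = (\int[P]_x mu [set y | B (upd k x y)])%E.
Proof.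
move=> mB; have [PQ [PQX PQ1 _]] := product_probability P mu.
rewrite -(resample_image PQX mB) PQ1//.
by rewrite -[X in measurable X]setTI; exact: measurable_upd.
Qed.

Lemma resample_left (B : set (BorN d n)) : measurable B ->
  P B = (\int[mu]_y P [set x | B (upd k x y)])%E.
Proof.
move=> mB; have [PQ [PQX _ PQ2]] := product_probability P mu.
rewrite -(resample_image PQX mB) PQ2//.
by rewrite -[X in measurable X]setTI; exact: measurable_upd.
Qed.

Lemma mean_resample_right (g : BorN d n -> R) : bounded_measurable g ->
  mean P g = mean P (fun x => mean mu (fun y => g (upd k x y))).
Proof.
move=> bg.
by have [_ ->] := bounded_disintegration (measurable_cst (mu : pprobability (Bor d) R))
  (measurable_upd k) resample_right bg.
Qed.

Lemma mean_resample_left (g : BorN d n -> R) : bounded_measurable g ->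
  bounded_measurable (fun y : Bor d => mean P (fun x => g (upd k x y))) /\
  mean P g = mean mu (fun y => mean P (fun x => g (upd k x y))).
Proof.
move=> bg.
exact: (bounded_disintegration (measurable_cst (P : pprobability (BorN d n) R))
  (measurable_upd_swap k) resample_left bg).
Qed.

Lemma prod_marginal (B : set (Bor d)) : measurable B -> P ((fun x => x k) @^-1` B) = mu B.
Proof.
move=> mB; rewrite resample_left; last first.
  by rewrite -[X in measurable X]setTI; exact: (measurable_coord dP k).
transitivity (\int[mu]_y (\1_B y)%:E)%E; last by rewrite integral_indic// setIT.
apply: eq_integral => y _ /=.
rewrite indicE /upd eqxx; have [By|By] := boolP (y \in B).
  rewrite (_ : [set x | _] = setT) ?probability_setT//.
  by apply/seteqP; split => // x _ /=; exact: set_mem.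
rewrite (_ : [set x | _] = set0) ?measure0//.
by apply/seteqP; split => // x /= /mem_set; rewrite (negPf By).
Qed.

End Resample.

(** Append one independent coordinate at a time, starting from the Dirac mass at the empty tuple.
    Existence is needed to apply the n-dimensional inequalities, which take the product measure as
    given. *)
Lemma prod_meas_exists (mu : probability (Bor d) R) n :
  exists P : probability (BorN d n) R, is_prod_meas mu P.
Proof.
elim: n => [|n [P prodP]].
  exists (dirac ((fun=> point) : BorN d 0) : probability (BorN d 0) R) => A _.
  rewrite big_ord0; have -> : [set x : BorN d 0 | forall i, A i (x i)] = setT.
    by apply/seteqP; split => // x _ [].
  exact: diracT.
have [PQ [PQX _ _]] := product_probability P mu.
have ms : measurable_fun [set: BorN d n * Bor d] (fun z => snoc z.1 z.2 : BorN d n.+1).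
  apply: (measurable_fun_BorN dP dsep) => i; rewrite /snoc; case: unliftP => [j _|_].
    exact: (measurableT_comp (measurable_coord dP j) measurable_fst).
  exact: measurable_snd.
have [Q QE] := probability_image PQ ms.
exists Q => A mA; rewrite QE; last exact: measurable_box.
(* The product over ['I_n.+1] splits with [widen_ord], whereas [snoc] indexes the old coordinates by
   [lift ord_max]. *)
have widenE (j : 'I_n) : widen_ord (leqnSn n) j = lift ord_max j.
  by apply: val_inj; rewrite /= /bump leqNgt ltn_ord add0n.
rewrite (_ : _ @^-1` _ = [set x | forall j, A (lift ord_max j) (x j)] `*` A ord_max); last first.
  apply/seteqP; split => -[x y] /=; rewrite /snoc => h.
    split; last by have := h ord_max; rewrite unlift_none.
    by move=> j; have := h (lift ord_max j); rewrite liftK.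
  by case: h => h Ay i; case: unliftP => [j ->|->].
rewrite PQX//; last by exact: (@measurable_box _ _ _ dP _ (fun j => A (lift ord_max j))).
rewrite (prodP (fun j => A (lift ord_max j)) (fun j => mA (lift ord_max j))).
rewrite big_ord_recr/=; congr (_ * _)%E.
by apply: eq_bigr => j _; rewrite widenE.
Qed.

(* Both families of conditional laws satisfy this: redrawing coordinate k from kap k leaves
   unchanged the law of the coordinates up to k. *)
Definition resampling n (nu : probability (BorN d n) R)
    (kap : 'I_n -> BorN d n -> pprobability (Bor d) R) :=
  forall k : 'I_n, measurable_fun setT (kap k) /\
    forall B : set (BorN d n), measurable B ->
      (forall x x', (forall i : 'I_n, (i <= k)%N -> x i = x' i) -> B x -> B x') ->
      nu B = (\int[nu]_x ((kap k x : probability (Bor d) R) [set y | B (upd k x y)]))%E.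

Lemma resampling_others n (nu : probability (BorN d n) R) kap :
  cond_others nu kap -> resampling nu (fun k x => kap k (Defs.drop k x)).
Proof.
move=> h k; have [mk hk] := h k; split=> [|B mB _].
  exact: (measurableT_comp mk (measurable_drop k)).
by rewrite hk//; apply: eq_integral => x _; under eq_fun do rewrite ins_drop.
Qed.

Lemma snoc_firstk n (k : 'I_n) (x : 'I_n -> E) y :
  snoc (firstk (ltnW (ltn_ord k)) x) y = firstk (ltn_ord k) (upd k x y).
Proof.
apply/funext => i; rewrite /snoc /firstk /upd; case: unliftP => [j ->|->].
  rewrite ifF.
    by congr x; apply: val_inj; rewrite /= /bump leqNgt ltn_ord add0n.
  apply/negbTE/eqP => /(congr1 val); rewrite /= /bump leqNgt ltn_ord add0n => jk.
  by have := ltn_ord j; rewrite jk ltnn.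
by rewrite ifT//; apply/eqP/val_inj.
Qed.

Lemma resampling_seq n (nu : probability (BorN d n) R) kh :
  cond_seq nu kh ->
  resampling nu (fun k x => kh k (firstk (ltnW (ltn_ord k)) x)).
Proof.
move=> h k; have [mk hk] := h k; split=> [|B mB Bk].
  exact: (measurableT_comp mk (measurable_firstk _)).
pose ext (z : 'I_k.+1 -> E) : 'I_n -> E :=
  fun i => if (insub (val i) : option 'I_k.+1) is Some j then z j else point.
have mext : measurable_fun [set: BorN d k.+1] (ext : BorN d k.+1 -> BorN d n).
  apply: (measurable_fun_BorN dP dsep) => i; rewrite /ext; case: insubP => [j _ _|_].
    exact: (measurable_coord dP).
  exact: measurable_cst.
have extE (x : 'I_n -> E) (i : 'I_n) : (i <= k)%N -> ext (firstk (ltn_ord k) x) i = x i.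
  by move=> ik; rewrite /ext; case: insubP => [j _ ji|]; rewrite ?ltnS ?ik//;
    congr x; apply: val_inj.
have BE (x : 'I_n -> E) : B (ext (firstk (ltn_ord k) x)) = B x.
  by apply/propext; split; apply: Bk => i ik; rewrite extE.
have := hk (ext @^-1` B); rewrite (_ : [set x | _] = B); last first.
  by apply/seteqP; split=> x /=; rewrite BE.
move=> ->; last by rewrite -[X in measurable X]setTI; exact: mext.
apply: eq_integral => x _; congr (Measure.sort _ _).
by apply/funext => y /=; rewrite snoc_firstk BE.
Qed.

(** Forget the coordinates beyond [k] by the map [tr]. Every preimage under [tr] satisfies the
    restriction in [resampling], so the image law disintegrates, and [g] does not see [tr]. *)
Lemma mean_resampling n (nu : probability (BorN d n) R) kap (k : 'I_n) (g : BorN d n -> R) :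
  resampling nu kap -> bounded_measurable g ->
  (forall x x', (forall i : 'I_n, (i <= k)%N -> x i = x' i) -> g x = g x') ->
  bounded_measurable (fun x => mean (kap k x) (fun y => g (upd k x y))) /\
  mean nu g = mean nu (fun x => mean (kap k x) (fun y => g (upd k x y))).
Proof.
move=> /(_ k)[mk hk] bg gk.
pose tr (x : 'I_n -> E) : 'I_n -> E := fun i => if (i <= k)%N then x i else point.
have mtr : measurable_fun [set: BorN d n] (tr : BorN d n -> BorN d n).
  apply: (measurable_fun_BorN dP dsep) => i; rewrite /tr; case: (i <= k)%N.
    exact: (measurable_coord dP).
  exact: measurable_cst.
have gtr x : g (tr x) = g x by apply: gk => i ik; rewrite /tr ik.
have [m mE] := probability_image nu mtr.
have mg : mean m g = mean nu g.
  rewrite (eq_mean_image mtr (fun B mB => esym (mE B mB)) bg).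
  by congr mean; apply/funext => x; rewrite gtr.
pose u (z : BorN d n * Bor d) : BorN d n := tr (upd k z.1 z.2).
have mu : measurable_fun setT u by apply: (measurableT_comp mtr); exact: measurable_upd.
have mB B : measurable B ->
    m B = (\int[nu]_x ((kap k x : probability (Bor d) R) [set y | B (u (x, y))]))%E.
  move=> mB; rewrite mE//; apply: hk.
    by rewrite -[X in measurable X]setTI; exact: mtr.
  move=> x x' xx' /=; rewrite (_ : tr x = tr x')//.
  by apply/funext => i; rewrite /tr; case: ifP => // /xx'.
have := bounded_disintegration mk mu mB bg.
rewrite mg (_ : (fun x => mean _ _) = fun x => mean (kap k x) (fun y => g (upd k x y)))//.
by apply/funext => x; congr mean; apply/funext => y; rewrite /u gtr.
Qed.

End ProductSpace.

(** * From transport to dual inequalities *)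

Section WeakDuality.
Variables (R : realType) (E : pointedType) (d : E -> E -> R).
Hypotheses (dP : is_pseudometric d) (dsep : metric_separable d).
Variables (n : nat) (C : R) (hC : 0 < C).
Variables (g : BorN d n -> R) (L M : R).
Hypothesis gM : forall x, `|g x| <= M.
Hypothesis gL : forall x y, `|g x - g y| <= L * dn d x y.
Implicit Types (x y w : 'I_n -> E) (k : nat).

Let dxx (x : E) : d x x = 0. Proof. by case: dP. Qed.
Let d0 (x y : E) : 0 <= d x y. Proof. by case: dP. Qed.

Definition mix k y x : 'I_n -> E := fun i => if (i < k)%N then y i else x i.

Definition agree k y : set ('I_n -> E) :=
  [set w | forall i : 'I_n, (i < k)%N -> w i = y i].

(* The first k coordinates are already transported (to y), the others still start at x. *)
Definition partial_sup k y x : R :=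
  sup [set g w - dn d (mix k y x) w ^+ 2 / C | w in agree k y].

Lemma agree_refl k y : agree k y y. Proof. by []. Qed.

Lemma agree_mix k y x : agree k y (mix k y x).
Proof. by move=> i ik; rewrite /mix ik. Qed.

Let penalty0 k y x w : 0 <= dn d (mix k y x) w ^+ 2 / C.
Proof. by rewrite divr_ge0 ?sqr_ge0// ltW. Qed.

Lemma partial_sup_ub k y x w : agree k y w ->
  g w - dn d (mix k y x) w ^+ 2 / C <= partial_sup k y x.
Proof.
move=> yw; apply: ub_le_sup; last by exists w.
exists M => _ [v _ <-]; have := gM v; have := penalty0 k y x v.
by rewrite ler_norml => h /andP[_ h']; lra.
Qed.

Lemma partial_sup_le k y x B :
  (forall w, agree k y w -> g w - dn d (mix k y x) w ^+ 2 / C <= B) ->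
  partial_sup k y x <= B.
Proof.
move=> h; apply: ge_sup; first by eexists; exists y => //; exact: (@agree_refl k y).
by move=> _ [w yw <-]; exact: h.
Qed.

Lemma norm_partial_sup k y x : `|partial_sup k y x| <= M.
Proof.
rewrite ler_norml; apply/andP; split.
  apply: le_trans _ (partial_sup_ub x (@agree_mix k y x)).
  have [_ dnxx _ _] := dn_pseudometric dP n.
  by rewrite dnxx expr0n mul0r subr0; have := gM (mix k y x); rewrite ler_norml => /andP[].
apply: partial_sup_le => w _; have := gM w; have := penalty0 k y x w.
by rewrite ler_norml => h /andP[_ h']; lra.
Qed.

Lemma bounded_partial_sup k y :
  bounded_measurable (partial_sup k y : BorN d n -> R).
Proof.
split; last by exists M => x; exact: norm_partial_sup.
apply: (@lsc_measurable R ('I_n -> E) (@dn R E d n)) => t x /= tx.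
have [w yw tw] : exists2 w, agree k y w & t < g w - dn d (mix k y x) w ^+ 2 / C.
  apply: contrapT => /forall2NP h; move: tx; apply/negP; rewrite -leNgt.
  by apply: partial_sup_le => w yw; have [//|/negP] := h w; rewrite -leNgt.
set q := dn d (mix k y x) w in tw.
have q0 : 0 <= q by exact: dn_ge0.
have qt : q ^+ 2 < C * (g w - t).
  by move: tw; rewrite ltrBrDr -ltrBrDl ltr_pdivrMr// mulrC.
(* A near-optimal [w] for [x] still beats the level [t] while the distance from the moved start to
   [w] stays below [sqrt (C (g w - t))]. *)
exists (Num.sqrt (C * (g w - t)) - q) => [|x' xx'].
  by rewrite subr_gt0 -[ltLHS]ger0_norm// -sqrtr_sqr ltr_sqrt// (le_lt_trans _ qt)// sqr_ge0.
apply: lt_le_trans (partial_sup_ub x' yw).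
rewrite ltrBrDr -ltrBrDl ltr_pdivrMr// mulrC.
have x'w : dn d (mix k y x') w < Num.sqrt (C * (g w - t)).
  have [_ _ dnC dnT] := dn_pseudometric dP n.
  apply: le_lt_trans (dnT _ (mix k y x) _) _; rewrite -ltrBrDr (le_lt_trans _ xx')// dnC.
  by apply: dn_le => // i; rewrite /mix; case: ifP => // _; rewrite dxx.
rewrite -[ltRHS]sqr_sqrtr; last by rewrite ltW// (le_lt_trans _ qt)// sqr_ge0.
by rewrite ltrXn2r ?nnegrE ?dn_ge0 ?sqrtr_ge0.
Qed.

(** Dependence on the first [k] coordinates alone is what makes the resampling identity applicable
    to [partial_value]. *)
Lemma eq_partial_sup k y y' : (forall i : 'I_n, (i < k)%N -> y i = y' i) ->
  partial_sup k y = partial_sup k y'.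
Proof.
move=> yy'; apply/funext => x; rewrite /partial_sup.
have -> : mix k y x = mix k y' x.
  by apply/funext => i; rewrite /mix; case: ifP => // /yy'.
congr (sup (image _ _)); apply/seteqP; split=> w h i ik; rewrite h//; last exact/esym/yy'.
exact: yy'.
Qed.

(** From a competitor [w] for [y], overwrite the first [k] coordinates by those of [y']: the penalty
    is unchanged and [g] moves by at most [L * dn d y y']. This gives measurability in [y]. *)
Lemma partial_sup_lipschitz k y y' x : 0 <= L ->
  partial_sup k y x <= partial_sup k y' x + L * dn d y y'.
Proof.
move=> L0; apply: partial_sup_le => w yw; rewrite -lerBlDr.
apply: le_trans _ (partial_sup_ub x (@agree_mix k y' w)).
have -> : dn d (mix k y' x) (mix k y' w) = dn d (mix k y x) w.
  rewrite /dn; congr Num.sqrt; apply: eq_bigr => i _; rewrite /mix; case: ifP => // ik.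
  by rewrite yw// !dxx.
have : dn d w (mix k y' w) <= dn d y y'.
  apply: dn_le => // i; rewrite /mix; case: ifP => [/yw ->//|_]; rewrite dxx//.
move/(ler_wpM2l L0) => h1; have := gL w (mix k y' w); rewrite ler_norml => /andP[_ h2].
lra.
Qed.

Lemma partial_sup_full y x : partial_sup n y x = g y.
Proof.
have mixE w : mix n y w = y by apply/funext => i; rewrite /mix ltn_ord.
have [_ dnxx _ _] := dn_pseudometric dP n.
apply/eqP; rewrite eq_le; apply/andP; split.
  apply: partial_sup_le => w yw; have -> : w = y by apply/funext => i; exact: yw.
  by rewrite mixE dnxx expr0n mul0r subr0.
by have := partial_sup_ub x (@agree_refl n y); rewrite mixE dnxx expr0n mul0r subr0.
Qed.

(* Maximise [L r - r^2 / C] over r. *)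
Lemma partial_sup0_le y x : partial_sup 0 y x <= g x + C * L ^+ 2 / 4.
Proof.
apply: partial_sup_le => w _; have -> : mix 0 y x = x by apply/funext.
set r := dn d x w; have := gL w x; rewrite ler_norml => /andP[_].
have [_ _ dnC _] := dn_pseudometric dP n; rewrite dnC -/r => h.
have : 0 <= (r - C * L / 2) ^+ 2 / C by rewrite divr_ge0 ?sqr_ge0// ltW.
have -> : (r - C * L / 2) ^+ 2 / C = r ^+ 2 / C - L * r + C * L ^+ 2 / 4.
  by field; rewrite gt_eqF.
by lra.
Qed.

(** Every competitor at stage [k.+1] has [k]-th coordinate [v]. It also competes at stage [k] from a
    start with [k]-th coordinate [z], where the only additional penalty is [d z v ^+ 2 / C]. *)
Lemma partial_sup_upd (k : 'I_n) y x (z v : E) :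
  partial_sup k.+1 (upd k y v) x <= partial_sup k y (upd k x z) + d z v ^+ 2 / C.
Proof.
apply: partial_sup_le => w yw.
have yw' : agree k y w.
  by move=> i ik; rewrite yw ?ltnS 1?ltnW// /upd ifF//; apply/negbTE; rewrite -val_eqE/= ltn_eqF.
have wk : w k = v by rewrite yw// /upd eqxx.
rewrite -lerBlDr; apply: le_trans _ (partial_sup_ub _ yw').
rewrite -addrA lerD2l -opprD lerN2 -mulrDl ler_wpM2r ?invr_ge0 ?(ltW hC)// !dn_sqr//.
rewrite (bigD1 k)//= {1}/mix ltnn /upd eqxx wk addrC lerD2r.
rewrite [leRHS](bigD1 k)//= [X in d X (w k)]/mix ltnSn eqxx wk dxx expr0n add0r.
apply: ler_sum => i /negPf ik; have ik' : ((i : nat) == k) = false by exact: ik.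
have ikk : (i < k.+1)%N = (i < k)%N by rewrite ltnS leq_eqVlt ik'.
by rewrite /mix ik ikk; case: ifP.
Qed.

Variables (mu : probability (Bor d) R) (P : probability (BorN d n) R).
Hypothesis prodP : is_prod_meas mu P.
Hypothesis L0 : 0 <= L.

Definition partial_value k (y : BorN d n) : R := mean P (partial_sup k y).

Lemma norm_partial_value k y : `|partial_value k y| <= M.
Proof. by apply: norm_mean; [exact: bounded_partial_sup|move=> x; exact: norm_partial_sup]. Qed.

Lemma bounded_partial_value k : bounded_measurable (partial_value k).
Proof.
split; last by exists M; exact: norm_partial_value.
apply: (@lipschitz_measurable R ('I_n -> E) (@dn R E d n) (dn_pseudometric dP n) _ L) => x y.
have [_ _ dnC _] := dn_pseudometric dP n.
have key u v : partial_value k u <= partial_value k v + L * dn d u v.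
  rewrite -{1}(mean_cst P (L * dn d u v)) -meanD; last exact: bounded_measurable_cst.
    apply: le_mean => [||t].
    - exact: bounded_partial_sup.
    - by apply: bounded_measurableD; [exact: bounded_partial_sup|exact: bounded_measurable_cst].
    - exact: partial_sup_lipschitz.
  exact: bounded_partial_sup.
move: (key x y) (key y x); rewrite (dnC y x).
move: (partial_value k x) (partial_value k y) (dn d x y) => a b c h1 h2.
by rewrite ler_norml; apply/andP; split; lra.
Qed.

(** Integrate the pointwise inequality of [partial_sup_upd] against the coupling. By
    [mean_resample_left] the [mu]-mean of [Phi] is [partial_value k y]. *)
Lemma partial_value_step (k : 'I_n) y (kap : probability (Bor d) R)
    (pi : probability (Bor d * Bor d)%type R) (r : R) :
  coupling mu kap pi -> (\int[pi]_z (d z.1 z.2 ^+ 2)%:E <= r%:E)%E ->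
  mean kap (fun v => partial_value k.+1 (upd k y v)) <= partial_value k y + r / C.
Proof.
move=> cpi ir.
have [bPhi PhiE] := mean_resample_left dP dsep prodP k (bounded_partial_sup k y).
set Phi := fun z => mean P _ in bPhi PhiE.
have bG : bounded_measurable (fun v : Bor d => partial_value k.+1 (upd k y v)).
  apply: (bounded_measurable_comp (g := fun v : Bor d => upd k y v : BorN d n))
    (bounded_partial_value k.+1).
  exact: (measurableT_comp (measurable_upd dP dsep k) (pair1_measurable (y : BorN d n))).
have pt z v : partial_value k.+1 (upd k y v) - Phi z <= d z v ^+ 2 / C.
  rewrite lerBlDl /partial_value /Phi -{1}(mean_cst P (d z v ^+ 2 / C)).
  have bz : bounded_measurable (fun x : BorN d n => partial_sup k y (upd k x z)).
    apply: (bounded_measurable_comp (g := fun x : BorN d n => upd k x z : BorN d n))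
      (bounded_partial_sup k y).
    exact: (measurableT_comp (measurable_upd dP dsep k) (pair2_measurable (z : Bor d))).
  rewrite -meanD//; last exact: bounded_measurable_cst.
  apply: le_mean.
  - exact: bounded_partial_sup.
  - by apply: bounded_measurableD => //; exact: bounded_measurable_cst.
  - by move=> x; exact: partial_sup_upd.
have bG2 := bounded_measurable_comp (T1 := (Bor d * Bor d)%type) measurable_snd bG.
have bPhi1 := bounded_measurable_comp (T1 := (Bor d * Bor d)%type) measurable_fst bPhi.
pose F (z : Bor d * Bor d) := partial_value k.+1 (upd k y z.2) - Phi z.1.
have bF : bounded_measurable F := bounded_measurableB bG2 bPhi1.
have FE : mean pi F = mean kap (fun v => partial_value k.+1 (upd k y v)) - partial_value k y.
  apply: etrans (meanB pi bG2 bPhi1) _; congr (_ - _).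
    exact: (mean_coupling_snd cpi bG).
  exact: etrans (mean_coupling_fst cpi bPhi) (esym PhiE).
have ptF z : C * F z <= d z.1 z.2 ^+ 2 by rewrite -ler_pdivlMl// mulrC; exact: pt.
rewrite -lerBlDl -FE; move: ptF bF; clearbody F => {FE} ptF bF.
rewrite ler_pdivlMr// mulrC -(meanZ pi C bF) -lee_fin; apply: le_trans ir.
apply: integral_ge_mean.
- exact: bounded_measurableZ.
- by apply/measurable_EFinP/measurable_funX; exact: measurable_dist.
- by move=> z; rewrite lee_fin.
Qed.

Variable alpha : pprobability (Bor d) R -> \bar R.
Hypothesis malpha : measurable_fun [set: pprobability (Bor d) R] alpha.
Hypothesis alpha_lb : exists m : R, forall nu, (m%:E <= alpha nu)%E.
Hypothesis T2 : forall nu : probability (Bor d) R,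
  (Wpow (T := Bor d) d 2 mu nu <= C%:E * alpha nu)%E.

Lemma partial_value_le_alpha (k : 'I_n) y (kap : probability (Bor d) R) :
  ((mean kap (fun v => partial_value k.+1 (upd k y v)) - partial_value k y)%:E <= alpha kap)%E.
Proof.
have [m alpha_m] := alpha_lb; have := alpha_m kap; have := T2 kap.
case: (alpha kap) => [a| |] h //; last by move=> _; rewrite leey.
move=> _.
rewrite lee_fin; apply/ler_addgt0Pr => e e0.
(* The slack [C * e] produces a nearly optimal coupling and becomes [e] after division by [C]. *)
have : (Wpow (T := Bor d) d 2 mu kap < (C * a + C * e)%:E)%E.
  by apply: le_lt_trans h _; rewrite -EFinM lte_fin ltrDl mulr_gt0.
case/ereal_inf_lt => _ [pi cpi <-] /ltW ir.
have := partial_value_step k y cpi ir.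
by rewrite -mulrDr mulrAC divff ?gt_eqF// mul1r; lra.
Qed.

Theorem resampling_bound (nu : probability (BorN d n) R) kap : resampling nu kap ->
  ((mean nu g)%:E - \int[nu]_x (\sum_(k < n) alpha (kap k x)) <=
   (mean P g + C * L ^+ 2 / 4)%:E)%E.
Proof.
move=> rkap.
have bg : bounded_measurable g.
  split; last by exists M.
  exact: (lipschitz_measurable (T := ('I_n -> E)) (dn_pseudometric dP n) gL).
have res (k : 'I_n) := mean_resampling dP dsep (k := k) rkap (bounded_partial_value k.+1).
(* [D k] is the expected increment of the partial value when coordinate [k] is redrawn. It is at
   most [alpha (kap k x)] pointwise, and its [nu]-means telescope by resampling. *)
pose D (k : 'I_n) (x : BorN d n) :=
  mean (kap k x) (fun v => partial_value k.+1 (upd k x v)) - partial_value k x.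
have dep (k : 'I_n) x x' : (forall i : 'I_n, (i <= k)%N -> x i = x' i) ->
    partial_value k.+1 x = partial_value k.+1 x'.
  by move=> xx'; rewrite /partial_value (eq_partial_sup (y' := x')).
have bD (k : 'I_n) : bounded_measurable (D k).
  by apply: bounded_measurableB; [have [] := res k (dep k)|exact: bounded_partial_value].
have meanDk (k : 'I_n) : mean nu (D k) = mean nu (partial_value k.+1) - mean nu (partial_value k).
  have [b1 h1] := res k (dep k).
  apply: etrans (meanB nu b1 (bounded_partial_value k)) _.
  by congr (_ - _); exact: esym.
have telescope : mean nu (fun x => \sum_(k < n) D k x) = mean nu g - mean nu (partial_value 0).
  rewrite mean_sum//; under eq_bigr do rewrite meanDk.
  rewrite -(big_mkord xpredT (fun k => mean nu (partial_value k.+1) - mean nu (partial_value k))).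
  rewrite telescope_sumr//; congr (mean nu _ - _); apply/funext => y.
  rewrite /partial_value (_ : partial_sup n y = fun=> g y) ?mean_cst//.
  by apply/funext => x; rewrite partial_sup_full.
have le_alpha : ((mean nu (fun x => \sum_(k < n) D k x))%:E <=
    \int[nu]_x (\sum_(k < n) alpha (kap k x)))%E.
  apply: integral_ge_mean.
  - exact: bounded_measurable_sum.
  - apply: emeasurable_sum => k; apply: (measurableT_comp malpha).
    by have [] := rkap k.
  - move=> x; rewrite -sumEFin; apply: lee_sum => k _; exact: partial_value_le_alpha.
apply: (@le_trans _ _ ((mean nu g)%:E - (mean nu g - mean nu (partial_value 0))%:E)%E).
  by apply: leeB => //; rewrite -telescope.
rewrite -EFinB lee_fin opprB addrC subrK.
apply: mean_le_cst; first exact: bounded_partial_value.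
move=> y; rewrite -(mean_cst P (C * L ^+ 2 / 4)) -meanD//; last exact: bounded_measurable_cst.
apply: le_mean; first exact: bounded_partial_sup.
  by apply: bounded_measurableD => //; exact: bounded_measurable_cst.
by move=> x; exact: partial_sup0_le.
Qed.

End WeakDuality.

(** * From dual inequalities to concentration *)

Section KantorovichRubinstein.
Variables (R : realType) (T : pointedType) (dist : T -> T -> R).
Hypothesis distP : is_pseudometric dist.

(* Replace the potentials by the Lipschitz function [f y = inf_x (phi x + dist x y)],
   which lies between psi and phi. *)
Lemma lipschitz_dual_bound (mu nu : probability (Bor dist) R) A :
  (forall f : Bor dist -> R, (exists M, forall x, `|f x| <= M) ->
    (forall x y, `|f x - f y| <= dist x y) -> mean nu f - mean mu f <= A) ->
  dual_bound 1 mu nu A.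
Proof.
move=> H phi psi bphi bpsi h.
have [d0 dxx dC dT] := distP.
pose S y := [set phi x + dist x y | x in [set: T]].
pose f y := inf (S y).
have [_ [M phiM]] := bphi.
have S0 y : S y !=set0 by exists (phi y + dist y y); exists y.
have lbS y : lbound (S y) (- M).
  move=> _ [x _ <-]; have := phiM x; have := d0 x y.
  by rewrite ler_norml => h1 /andP[h2 _]; lra.
have fle y x : f y <= phi x + dist x y.
  by apply: ge_inf; [exists (- M); exact: lbS|exists x].
have lef y B : (forall x, B <= phi x + dist x y) -> B <= f y.
  by move=> hB; apply: lb_le_inf => // _ [x _ <-].
have flip x y : f x <= f y + dist x y.
  rewrite -lerBlDr; apply: lef => z; rewrite lerBlDr (le_trans (fle x z))// -addrA lerD2l.
  by rewrite (dC x y); exact: dT.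
have fL x y : `|f x - f y| <= dist x y.
  have := flip x y; have := flip y x; rewrite (dC y x) ler_norml => h1 h2.
  by apply/andP; split; lra.
have fM x : `|f x| <= M.
  rewrite ler_norml (lef x (- M)) /=; last by move=> z; apply: lbS; exists z.
  by rewrite (le_trans (fle x x))// dxx addr0 (le_trans (ler_norm _) (phiM x)).
have bf : bounded_measurable (f : Bor dist -> R).
  split; last by exists M.
  by apply: (lipschitz_measurable (L := 1) distP) => x y; rewrite mul1r.
apply: le_trans (H f _ fL); last by exists M.
apply: lerB; apply: le_mean => // y.
- by apply: lef => x; rewrite -lerBlDl -[leRHS]expr1.
- by have := fle y y; rewrite dxx addr0.
Qed.

End KantorovichRubinstein.

Section TransportBound.
Variables (R : realType) (E : pointedType) (d : E -> E -> R).
Hypotheses (dP : is_pseudometric d) (dsep : metric_separable d).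
Variables (n : nat) (mu : probability (Bor d) R) (P : probability (BorN d n) R).
Hypothesis prodP : is_prod_meas mu P.

Lemma prod_moment x0 : (\int[mu]_x (d x x0 ^+ 2)%:E < +oo)%E ->
  (\int[P]_x (dn d x (fun=> x0) ^+ 1)%:E < +oo)%E.
Proof.
move=> imu.
have md : measurable_fun [set: Bor d] (fun x : Bor d => (d x x0 ^+ 2)%:E).
  by apply/measurable_EFinP/measurable_funX; exact: measurable_distr.
have mdi (i : 'I_n) : measurable_fun [set: BorN d n] (fun x : BorN d n => (d (x i) x0 ^+ 2)%:E).
  exact: (measurableT_comp md (measurable_coord dP i)).
(* The bound [t <= 1 + t^2] trades the first moment of [dn] for the sum of the second moments of the
   coordinates. *)
apply: (@le_lt_trans _ _ (\int[P]_x (1 + \sum_(i < n) (d (x i) x0 ^+ 2)%:E))%E).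
  apply: ge0_le_integral => //.
  - by move=> x _; rewrite lee_fin expr1 dn_ge0.
  - apply/measurable_EFinP/measurable_funX.
    exact: (measurable_distr (dn_pseudometric dP n)).
  - by apply: emeasurable_funD => //; exact: emeasurable_sum.
  - move=> x _; rewrite sumEFin -EFinD lee_fin -dn_sqr expr1.
    by have := sqr_ge0 (dn d x (fun=> x0) - 1); rewrite sqrrB1; have := dn_ge0 d x (fun=> x0); lra.
rewrite ge0_integralD//; last 2 first.
- by move=> x _; apply: sume_ge0 => i _; rewrite lee_fin sqr_ge0.
- exact: emeasurable_sum.
rewrite integral_cst//= probability_setT mule1 lte_add_pinfty ?ltry//.
rewrite ge0_integral_sum//; last by move=> i x _; rewrite lee_fin sqr_ge0.
apply: lte_sum_pinfty => i _.
rewrite -(eq_ge0_integral_image (measurable_coord dP i) (prod_marginal dP dsep prodP i)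
  (f := fun x : Bor d => (d x x0 ^+ 2)%:E))// => x.
by rewrite lee_fin sqr_ge0.
Qed.

Variables (C : R) (hC : 0 < C) (nu : probability (BorN d n) R) (a : \bar R) (x0 : E).
Hypothesis imu : (\int[mu]_x (d x x0 ^+ 2)%:E < +oo)%E.
Hypothesis H : forall (lambda : R) (f : BorN d n -> R), (exists M, forall x, `|f x| <= M) ->
  (forall x y, `|f x - f y| <= dn d x y) ->
  (\int[nu]_x (lambda * f x)%:E - a <=
    lambda%:E * (\int[P]_x (f x)%:E) + (C * lambda ^+ 2 / 4)%:E)%E.

Lemma transport_bound :
  (Wpow (T := BorN d n) (@dn R E d n) 1 P nu * Wpow (T := BorN d n) (@dn R E d n) 1 P nu
    <= C%:E * a)%E.
Proof.
have dnP := dn_pseudometric dP n.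
have bfun (f : BorN d n -> R) : (exists M, forall x, `|f x| <= M) ->
    (forall x y, `|f x - f y| <= dn d x y) -> bounded_measurable f.
  move=> fM fL; split=> //.
  by apply: (lipschitz_measurable (T := ('I_n -> E)) (L := 1) dnP) => x y; rewrite mul1r.
have H' (r : R) lambda f : a = r%:E -> (exists M, forall x, `|f x| <= M) ->
    (forall x y, `|f x - f y| <= dn d x y) ->
    lambda * mean nu f - r <= lambda * mean P f + C * lambda ^+ 2 / 4.
  move=> ar fM fL; have bf := bfun f fM fL; have := H lambda fM fL.
  rewrite ar -(EFin_mean nu (bounded_measurableZ lambda bf)) -(EFin_mean P bf) (meanZ nu lambda bf).
  by rewrite -EFinB -EFinM -EFinD lee_fin.
(* The value [+oo] is trivial since [C > 0]; [-oo] contradicts the hypothesis at [lambda = 0], which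
   also gives [r >= 0] below. *)
case: a H H' => [r| |] Ha H'; last 2 first.
- by rewrite gt0_muley ?leey.
- have b0 : bounded_measurable (fun _ : BorN d n => 0 * 0 : R) by exact: bounded_measurable_cst.
  have : (\int[nu]_x (0 * 0 : R)%:E - -oo <=
      0%:E * \int[P]_x (0 : R)%:E + (C * 0 ^+ 2 / 4)%:E)%E.
    by apply: Ha => [|x y]; [exists 0 => x; rewrite normr0|rewrite subr0 normr0 dn_ge0].
  by rewrite mul0e add0e -(EFin_mean nu b0).
have r0 : 0 <= r.
  have : 0 * mean nu (fun=> 0) - r <= 0 * mean P (fun=> 0) + C * 0 ^+ 2 / 4.
    by apply: H' => // [|x y]; [exists 0 => x; rewrite normr0|rewrite subr0 normr0 dn_ge0].
  by rewrite !mul0r expr0n /= mulr0 mul0r addr0 sub0r oppr_le0.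
have Cr0 : 0 <= C * r by rewrite mulr_ge0// ltW.
have W : (Wpow (T := BorN d n) (@dn R E d n) 1 P nu <= (Num.sqrt (C * r))%:E)%E.
  have sep := dn_separable dP n dsep.
  apply: (@kantorovich_duality R ('I_n -> E) (@dn R E d n) dnP sep 1 (fun=> x0)).
    exact: prod_moment.
  apply: (lipschitz_dual_bound (T := ('I_n -> E)) dnP) => f fM fL.
  set K := mean nu f - mean P f.
  have [K0|/ltW K0] := leP K 0; first by rewrite (le_trans K0)// sqrtr_ge0.
  rewrite -[leLHS]ger0_norm// -sqrtr_sqr ler_wsqrtr//.
  (* This [lambda] maximises [lambda K - C lambda^2 / 4], with maximum [K^2 / C]. *)
  have := H' r (2 * K / C) f erefl fM fL.
  have -> : C * (2 * K / C) ^+ 2 / 4 = K ^+ 2 / C by field; rewrite gt_eqF.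
  have CK : (2 * K / C) * mean nu f - (2 * K / C) * mean P f = 2 * (K ^+ 2 / C).
    by rewrite -mulrBr -/K; field; rewrite gt_eqF.
  by move=> h; rewrite mulrC -ler_pdivrMr//; lra.
have W0 : (0 <= Wpow (T := BorN d n) (@dn R E d n) 1 P nu)%E.
  apply: le_ereal_inf_tmp => _ [pi _ <-]; apply: integral_ge0 => z _.
  by rewrite lee_fin exprn_ge0// dn_ge0.
apply: le_trans (lee_pmul W0 W0 W W) _.
by rewrite -!EFinM -expr2 sqr_sqrtr.
Qed.

End TransportBound.

(** * From concentration to transport *)

Section Tensorization.
Variables (R : realType) (E : pointedType) (d : E -> E -> R).
Hypotheses (dP : is_pseudometric d) (dsep : metric_separable d).

Lemma cond_others_prod n (nu : probability (Bor d) R) (Q : probability (BorN d n) R) :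
  is_prod_meas nu Q ->
  cond_others Q (fun _ _ => (nu : pprobability (Bor d) R)).
Proof.
move=> prodQ k; split=> [|A mA]; first exact: measurable_cst.
rewrite (resample_right dP dsep prodQ k mA); apply: eq_integral => x _.
by congr (Measure.sort _ _); apply/funext => y /=; rewrite ins_drop.
Qed.

Lemma cond_seq_prod n (nu : probability (Bor d) R) (Q : probability (BorN d n) R) :
  is_prod_meas nu Q ->
  cond_seq Q (fun _ _ => (nu : pprobability (Bor d) R)).
Proof.
move=> prodQ k; split=> [|B mB]; first exact: measurable_cst.
have mB' : measurable ((firstk (ltn_ord k) : BorN d n -> BorN d k.+1) @^-1` B).
  by rewrite -[X in measurable X]setTI; exact: (measurable_firstk dP dsep).
rewrite (_ : [set x | _] = (firstk (ltn_ord k) : BorN d n -> BorN d k.+1) @^-1` B)//.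
rewrite (resample_right dP dsep prodQ k mB'); apply: eq_integral => x _.
by congr (Measure.sort _ _); apply/funext => y /=; rewrite snoc_firstk.
Qed.

(* The cross terms vanish by resampling one coordinate. *)
Lemma mean_sqr_sum_le n (nu : probability (Bor d) R) (Q : probability (BorN d n) R)
    (h : Bor d -> R) B :
  is_prod_meas nu Q -> bounded_measurable h -> (forall x, `|h x| <= B) -> mean nu h = 0 ->
  mean Q (fun y => (\sum_(i < n) h (y i)) ^+ 2) <= n%:R * B ^+ 2.
Proof.
move=> prodQ bh hB h0.
have bi (i : 'I_n) : bounded_measurable (fun y : BorN d n => h (y i)).
  exact: (bounded_measurable_comp (measurable_coord dP i) bh).
have bij (i j : 'I_n) := bounded_measurableM (bi i) (bi j).
have -> : (fun y : BorN d n => (\sum_(i < n) h (y i)) ^+ 2) =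
    fun y : BorN d n => \sum_(i < n) \sum_(j < n) h (y i) * h (y j).
  apply/funext => y; rewrite expr2 mulr_suml; apply: eq_bigr => i _.
  by rewrite mulr_sumr.
rewrite mean_sum; last by move=> i; apply: bounded_measurable_sum.
apply: (@le_trans _ _ (\sum_(i < n) B ^+ 2)); last first.
  by rewrite sumr_const card_ord -[leLHS]mulr_natl.
apply: ler_sum => i _; rewrite mean_sum// (bigD1 i)//= big1 ?addr0.
  apply: mean_le_cst => // x; rewrite -expr2 -[leLHS]ger0_norm ?sqr_ge0// normrX.
  by rewrite lerXn2r ?nnegrE// (le_trans _ (hB (x i))).
move=> j ji; rewrite (mean_resample_right dP dsep prodQ j (bij i j)).
rewrite (_ : (fun x => _) = fun=> 0) ?mean_cst//.
apply/funext => x.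
rewrite (_ : (fun y => _) = fun y : Bor d => h (x i) * h y).
  by rewrite meanZ// h0 mulr0.
by apply/funext => y; rewrite /upd eqxx eq_sym (negPf ji).
Qed.

(** For [t >= 0], [sqrt t >= t (3 - t) / 2]: with [u = sqrt t] the difference is
    [u (u - 1)^2 (u + 2) / 2]. The parabola touches the root at [t = 1], so its mean involves only a
    mean and a variance. *)
Lemma sqrt_quadratic_lower (K D t : R) : 0 < K -> 0 <= D -> K * t <= D ^+ 2 ->
  Num.sqrt K * (t * (3 - t) / 2) <= D.
Proof.
move=> K0 D0 KtD; have [t0|t0] := leP t 0.
  apply: le_trans D0; rewrite mulr_ge0_le0 ?sqrtr_ge0//.
  by rewrite ler_pdivrMr// mul0r mulr_le0_ge0//; lra.
apply: (@le_trans _ _ (Num.sqrt K * Num.sqrt t)); last first.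
  rewrite -sqrtrM ?(ltW K0)// -[leRHS]ger0_norm// -sqrtr_sqr.
  exact: ler_wsqrtr.
rewrite ler_wpM2l ?sqrtr_ge0//.
set u := Num.sqrt t; have u0 : 0 <= u by exact: sqrtr_ge0.
have -> : t = u ^+ 2 by rewrite sqr_sqrtr// ltW.
have : 0 <= u * ((u - 1) ^+ 2 * (u + 2)).
  by apply: mulr_ge0 => //; apply: mulr_ge0; [exact: sqr_ge0|exact: addr_ge0].
by rewrite ler_pdivrMr//; nra.
Qed.

Section Deviation.
Variables (n : nat) (n0 : (0 < n)%N) (mu nu : probability (Bor d) R).
Variables (P Q : probability (BorN d n) R).
Hypotheses (prodP : is_prod_meas mu P) (prodQ : is_prod_meas nu Q).
Variables (phi psi : Bor d -> R) (B : R).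
Hypotheses (bphi : bounded_measurable phi) (bpsi : bounded_measurable psi).
Hypotheses (phiB : forall x, `|phi x| <= B) (psiB : forall x, `|psi x| <= B).
Hypothesis dual : forall x y, psi y - phi x <= d x y ^+ 2.

(** Summing the dual inequality gives [n K + U <= dn^2], where [U] is centred under every coupling.
    Apply the parabola to [1 + U / (n K)] and integrate: the linear term vanishes and the second
    moment of [U] gives the correction. *)
Lemma product_transport_lower (pi : probability (BorN d n * BorN d n)%type R) (w K : R) :
  coupling P Q pi -> K = mean nu psi - mean mu phi -> 0 < K ->
  (\int[pi]_z (dn d z.1 z.2 ^+ 1)%:E <= w%:E)%E ->
  Num.sqrt n%:R * Num.sqrt K * (1 - (16 * B ^+ 2 / n%:R) / (2 * K ^+ 2)) <= w.
Proof.
move=> cpi KE K0 iw.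
have nR : 0 < n%:R :> R by rewrite ltr0n.
pose ps y := psi y - mean nu psi; pose ph x := phi x - mean mu phi.
have bps : bounded_measurable ps by apply: bounded_measurableB => //; exact: bounded_measurable_cst.
have bph : bounded_measurable ph by apply: bounded_measurableB => //; exact: bounded_measurable_cst.
have ps0 : mean nu ps = 0 by rewrite meanB ?mean_cst ?subrr//; exact: bounded_measurable_cst.
have ph0 : mean mu ph = 0 by rewrite meanB ?mean_cst ?subrr//; exact: bounded_measurable_cst.
have psB y : `|ps y| <= 2 * B.
  by rewrite (le_trans (ler_normB _ _))// mulr_natl mulr2n lerD// norm_mean.
have phB y : `|ph y| <= 2 * B.
  by rewrite (le_trans (ler_normB _ _))// mulr_natl mulr2n lerD// norm_mean.
pose SP (x : BorN d n) := \sum_(i < n) ph (x i).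
pose SQ (y : BorN d n) := \sum_(i < n) ps (y i).
have bcoordP (i : 'I_n) : bounded_measurable (fun x : BorN d n => ph (x i)).
  exact: (bounded_measurable_comp (measurable_coord dP i) bph).
have bSP : bounded_measurable SP := bounded_measurable_sum _ bcoordP.
have bcoordQ (i : 'I_n) : bounded_measurable (fun x : BorN d n => ps (x i)).
  exact: (bounded_measurable_comp (measurable_coord dP i) bps).
have bSQ : bounded_measurable SQ := bounded_measurable_sum _ bcoordQ.
have SP0 : mean P SP = 0.
  rewrite mean_sum// big1// => i _.
  by rewrite -(eq_mean_image (measurable_coord dP i) (prod_marginal dP dsep prodP i) bph).
have SQ0 : mean Q SQ = 0.
  rewrite mean_sum// big1// => i _.
  by rewrite -(eq_mean_image (measurable_coord dP i) (prod_marginal dP dsep prodQ i) bps).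
have vP : mean P (fun x => SP x ^+ 2) <= n%:R * (2 * B) ^+ 2 := mean_sqr_sum_le prodP bph phB ph0.
have vQ : mean Q (fun x => SQ x ^+ 2) <= n%:R * (2 * B) ^+ 2 := mean_sqr_sum_le prodQ bps psB ps0.
pose U (z : BorN d n * BorN d n) := SQ z.2 - SP z.1.
have bSP1 := bounded_measurable_comp (T1 := (BorN d n * BorN d n)%type) measurable_fst bSP.
have bSQ2 := bounded_measurable_comp (T1 := (BorN d n * BorN d n)%type) measurable_snd bSQ.
have bU : bounded_measurable U := bounded_measurableB bSQ2 bSP1.
have U0 : mean pi U = 0.
  apply: etrans (meanB pi bSQ2 bSP1) _.
  have -> : mean pi (fun z => SQ z.2) = 0 by apply: etrans SQ0; exact: (mean_coupling_snd cpi bSQ).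
  have -> : mean pi (fun z => SP z.1) = 0 by apply: etrans SP0; exact: (mean_coupling_fst cpi bSP).
  by rewrite subrr.
have bU2 : bounded_measurable (fun z => U z ^+ 2) := bounded_measurableM bU bU.
have bSP2 : bounded_measurable (fun x => SP x ^+ 2) := bounded_measurableM bSP bSP.
have bSQ2' : bounded_measurable (fun x => SQ x ^+ 2) := bounded_measurableM bSQ bSQ.
(* The dependence between the two marginals is avoided by [(a - b)^2 <= 2 a^2 + 2 b^2]; each
   marginal sum has second moment at most [4 n B^2], whence 16. *)
have U2 : mean pi (fun z => U z ^+ 2) <= n%:R * (16 * B ^+ 2).
  have b1 := bounded_measurable_comp (T1 := (BorN d n * BorN d n)%type) measurable_fst bSP2.
  have b2 := bounded_measurable_comp (T1 := (BorN d n * BorN d n)%type) measurable_snd bSQ2'.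
  apply: (@le_trans _ _ (mean pi (fun z => 2 * SQ z.2 ^+ 2 + 2 * SP z.1 ^+ 2))).
    apply: le_mean => //.
      by apply: bounded_measurableD; exact: bounded_measurableZ.
    by move=> z; have := sqr_ge0 (SQ z.2 + SP z.1); rewrite /U sqrrB sqrrD; lra.
  rewrite (meanD pi (bounded_measurableZ 2 b2) (bounded_measurableZ 2 b1)).
  rewrite (meanZ pi 2 b2) (meanZ pi 2 b1).
  have e1 : mean pi (fun z => SQ z.2 ^+ 2) = mean Q (fun x => SQ x ^+ 2) :=
    mean_coupling_snd cpi bSQ2'.
  have e2 : mean pi (fun z => SP z.1 ^+ 2) = mean P (fun x => SP x ^+ 2) :=
    mean_coupling_fst cpi bSP2.
  by rewrite e1 e2; move: vP vQ; rewrite exprMn; lra.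
pose s (z : BorN d n * BorN d n) := U z / (n%:R * K).
have nK : 0 < n%:R * K by rewrite mulr_gt0.
have pt z : Num.sqrt (n%:R * K) * (1 + s z / 2 - s z ^+ 2 / 2) <= dn d z.1 z.2.
  have := @sqrt_quadratic_lower (n%:R * K) (dn d z.1 z.2) (1 + s z) nK (dn_ge0 _ _ _).
  have -> : (1 + s z) * (3 - (1 + s z)) / 2 = 1 + s z / 2 - s z ^+ 2 / 2 by field.
  apply; rewrite mulrDr mulr1 /s mulrCA divff ?gt_eqF// mulr1.
  have -> : n%:R * K + U z = \sum_(i < n) (psi (z.2 i) - phi (z.1 i)).
    rewrite /U /SQ /SP -sumrB (_ : n%:R * K = \sum_(i < n) K); last first.
      by rewrite sumr_const card_ord mulr_natl.
    by rewrite -big_split; apply: eq_bigr => i _; rewrite /= /ps /ph KE; ring.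
  rewrite dn_sqr; exact: ler_sum.
set r := Num.sqrt (n%:R * K) in pt.
pose b1 := r / 2 / (n%:R * K); pose b2 := r / 2 / (n%:R * K) ^+ 2.
pose F (z : BorN d n * BorN d n) := r + (b1 * U z - b2 * U z ^+ 2).
have FE z : F z = r * (1 + s z / 2 - s z ^+ 2 / 2).
  by rewrite /F /s /b1 /b2; field; rewrite !gt_eqF.
have bF1 := bounded_measurableB (bounded_measurableZ b1 bU) (bounded_measurableZ b2 bU2).
have bF : bounded_measurable F := bounded_measurableD (bounded_measurable_cst _ _) bF1.
have : mean pi F <= w.
  rewrite -lee_fin; apply: le_trans iw; apply: integral_ge_mean => //.
    apply/measurable_EFinP/measurable_funX.
    exact: (measurable_dist (T := ('I_n -> E)) (dn_pseudometric dP n) (dn_separable dP n dsep)).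
  by move=> z; rewrite lee_fin FE expr1.
apply: le_trans.
have -> : mean pi F = r - b2 * mean pi (fun z => U z ^+ 2).
  rewrite (meanD pi (bounded_measurable_cst _ r) bF1) mean_cst.
  rewrite (meanB pi (bounded_measurableZ b1 bU) (bounded_measurableZ b2 bU2)).
  by rewrite (meanZ pi _ bU) (meanZ pi _ bU2) U0 mulr0 sub0r.
rewrite -sqrtrM// -/r mulrBr mulr1 lerD2l lerN2.
have r0 : 0 <= r by exact: sqrtr_ge0.
have -> : r * (16 * B ^+ 2 / n%:R / (2 * K ^+ 2)) = b2 * (n%:R * (16 * B ^+ 2)).
  by rewrite /b2; field; rewrite !gt_eqF.
by rewrite ler_wpM2l// !mulr_ge0 ?invr_ge0// ?exprn_ge0// ltW.
Qed.

End Deviation.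

Variables (mu nu : probability (Bor d) R) (C a : R) (x0 : E).
Hypothesis imu : (\int[mu]_x (d x x0 ^+ 2)%:E < +oo)%E.
Hypothesis concentration : forall n (P Q : probability (BorN d n) R), (0 < n)%N ->
  is_prod_meas mu P -> is_prod_meas nu Q ->
  (Wpow (T := BorN d n) (@dn R E d n) 1 P Q * Wpow (T := BorN d n) (@dn R E d n) 1 P Q <=
   C%:E * (n%:R * a)%:E)%E.

Lemma Wpow_ge0 (T : pointedType) (dist : T -> T -> R) p (P Q : probability (Bor dist) R) :
  is_pseudometric dist -> (0 <= Wpow (T := Bor dist) dist p P Q)%E.
Proof.
case=> dist0 _ _ _; apply: le_ereal_inf_tmp => _ [pi _ <-]; apply: integral_ge0 => z _.
by rewrite lee_fin exprn_ge0.
Qed.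

Theorem transport_of_concentration : (Wpow (T := Bor d) d 2 mu nu <= C%:E * a%:E)%E.
Proof.
apply: (kantorovich_duality dP dsep imu) => phi psi bphi bpsi dual.
rewrite leNgt; apply/negP => Klt; set K := mean nu psi - mean mu phi in Klt.
have [[_ [B1 phiB1]] [_ [B2 psiB2]]] := (bphi, bpsi).
pose B := Num.max B1 B2.
have phiB x : `|phi x| <= B by rewrite le_max phiB1.
have psiB x : `|psi x| <= B by rewrite le_max psiB2 orbT.
have W0 n (P Q : probability (BorN d n) R) :
    (0 <= Wpow (T := BorN d n) (@dn R E d n) 1 P Q)%E.
  exact: (Wpow_ge0 _ _ _ (dn_pseudometric dP n)).
(* The case [n = 1] bounds [C a] below by a square, so [sqrt (C a)] squares back to [C a]. *)
have Ca0 : 0 <= C * a.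
  have [P prodP] := prod_meas_exists dP dsep mu 1.
  have [Q prodQ] := prod_meas_exists dP dsep nu 1.
  have := concentration (ltn0Sn 0) prodP prodQ.
  by rewrite mul1r -EFinM -lee_fin; apply: le_trans; rewrite mule_ge0.
have K0 : 0 < K by exact: le_lt_trans Klt.
pose w := Num.sqrt (C * a).
have w0 : 0 <= w by exact: sqrtr_ge0.
pose c := Num.sqrt K * (16 * B ^+ 2 / (2 * K ^+ 2)).
have c0 : 0 <= c.
  by apply: mulr_ge0; [exact: sqrtr_ge0|apply: divr_ge0; apply: mulr_ge0 => //; exact: sqr_ge0].
(* Taking [n = m^2] makes [sqrt n = m]. The term [c / m] is the variance correction, and the 1 is
   the slack of a nearly optimal coupling. Since [sqrt K > w], a large [m] gives a contradiction. *)
have main (m : nat) : (0 < m)%N -> m%:R * (Num.sqrt K - w) <= c + 1.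
  move=> m0; have m1 : 1 <= m%:R :> R by rewrite ler1n.
  have [P prodP] := prod_meas_exists dP dsep mu (m ^ 2).
  have [Q prodQ] := prod_meas_exists dP dsep nu (m ^ 2).
  have n0 : (0 < m ^ 2)%N by rewrite expn_gt0 m0.
  have W := concentration n0 prodP prodQ.
  have W1 : (Wpow (T := BorN d (m ^ 2)) (@dn R E d (m ^ 2)) 1 P Q < (m%:R * w + 1)%:E)%E.
    rewrite ltNge; apply/negP => h; move: W; apply/negP; rewrite -ltNge.
    have h0 : (0 <= (m%:R * w + 1)%:E)%E by rewrite lee_fin addr_ge0 ?mulr_ge0.
    apply: lt_le_trans (lee_pmul h0 h0 h h).
    rewrite -!EFinM lte_fin natrX mulrCA -(sqr_sqrtr Ca0) -/w -exprMn -expr2.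
    by rewrite ltrXn2r ?nnegrE ?addr_ge0 ?mulr_ge0 ?ltrDl.
  case/ereal_inf_lt : W1 => _ [pi cpi <-] /ltW iw.
  have := product_transport_lower n0 prodP prodQ bphi bpsi phiB psiB dual cpi (erefl K) K0 iw.
  rewrite natrX sqrtr_sqr ger0_norm//.
  have -> : m%:R * Num.sqrt K * (1 - 16 * B ^+ 2 / m%:R ^+ 2 / (2 * K ^+ 2)) =
      m%:R * Num.sqrt K - c / m%:R.
    by rewrite /c; field; rewrite !gt_eqF// (lt_le_trans _ m1).
  have : c / m%:R <= c by rewrite ler_pdivrMr ?(lt_le_trans _ m1)// ler_peMr.
  by rewrite mulrBr; lra.
have wK : 0 < Num.sqrt K - w by rewrite subr_gt0 ltr_sqrt.
have := main (Num.truncn ((c + 1) / (Num.sqrt K - w))).+1 (ltn0Sn _).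
by rewrite -ler_pdivlMr// leNgt truncnS_gt.
Qed.

End Tensorization.

(** * Assembly of the five equivalent assertions *)

Theorem mainTheorem5 (R : realType) (E : pointedType) (d : E -> E -> R)
  (hmetric : is_metric d) (hcomplete : metric_complete d)
  (hsep : metric_separable d)
  (alpha : pprobability (Bor d) R -> \bar R)
  (halpha_meas : measurable_fun setT alpha)
  (halpha_lb : exists m : R, forall nu, (m%:E <= alpha nu)%E)
  (halpha_fin : exists nu, (alpha nu < +oo)%E)
  (mu : probability (Bor d) R)
  (hmom : exists x0 : E, (\int[mu]_x ((d x x0) ^+ 2)%:E < +oo)%E)
  (C : R) (hC : 0 < C) :
  let S1 := forall nu : probability (Bor d) R,
      (Wpow (T:=Bor d) d 2 mu nu <= C%:E * alpha nu)%E in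
  let S2 := forall n : nat, (0 < n)%N ->
      forall P : probability (BorN d n) R, is_prod_meas mu P ->
      forall (nu : probability (BorN d n) R)
             (kap : 'I_n -> BorN d n.-1 -> pprobability (Bor d) R),
        cond_others nu kap ->
        (Wpow (T:=BorN d n) (@dn R E d n) 1 P nu * Wpow (T:=BorN d n) (@dn R E d n) 1 P nu
           <= C%:E * alpha_n alpha nu kap)%E in
  let S2' := forall n : nat, (0 < n)%N ->
      forall P : probability (BorN d n) R, is_prod_meas mu P ->
      forall (nu : probability (BorN d n) R)
             (kh : forall k : 'I_n, BorN d k -> pprobability (Bor d) R),
        cond_seq nu kh ->
        (Wpow (T:=BorN d n) (@dn R E d n) 1 P nu * Wpow (T:=BorN d n) (@dn R E d n) 1 P nu
           <= C%:E * alphahat_n alpha nu kh)%E in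
  let S3 := forall n : nat, (0 < n)%N ->
      forall P : probability (BorN d n) R, is_prod_meas mu P ->
      forall (lambda : R) (f : BorN d n -> R),
        (exists M : R, forall x, `|f x| <= M) ->
        (forall x y, `|f x - f y| <= @dn R E d n x y) ->
        (rho_n alpha (fun x => (lambda * f x)%R)
           <= lambda%:E * (\int[P]_x (f x)%:E) + (C * lambda ^+ 2 / 4)%R%:E)%E in
  let S3' := forall n : nat, (0 < n)%N ->
      forall P : probability (BorN d n) R, is_prod_meas mu P ->
      forall (lambda : R) (f : BorN d n -> R),
        (exists M : R, forall x, `|f x| <= M) ->
        (forall x y, `|f x - f y| <= @dn R E d n x y) ->
        (rhohat_n alpha (fun x => (lambda * f x)%R)
           <= lambda%:E * (\int[P]_x (f x)%:E) + (C * lambda ^+ 2 / 4)%R%:E)%E in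
  [/\ S1 <-> S2, S1 <-> S2', S1 <-> S3 & S1 <-> S3'].
Proof.
have dP : is_pseudometric d := metric_pseudometric hmetric.
move=> S1 S2 S2' S3 S3'.
have [x0 imu] := hmom.
(* Both families of conditional laws are handled at once through [resampling]. *)
have resampling_dual n (f : BorN d n -> R) (P nu : probability (BorN d n) R)
    (kap : 'I_n -> BorN d n -> pprobability (Bor d) R) (lambda : R) :
    S1 -> is_prod_meas mu P -> resampling nu kap ->
    (exists M : R, forall x, `|f x| <= M) ->
    (forall x y, `|f x - f y| <= @dn R E d n x y) ->
    (\int[nu]_x (lambda * f x)%:E - \int[nu]_x (\sum_(k < n) alpha (kap k x)) <=
     lambda%:E * (\int[P]_x (f x)%:E) + (C * lambda ^+ 2 / 4)%R%:E)%E.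
  move=> s1 prodP rkap [M fM] fL.
  have bf : bounded_measurable f.
    split; last by exists M.
    apply: (lipschitz_measurable (T := ('I_n -> E)) (L := 1) (dn_pseudometric dP n)) => x y.
    by rewrite mul1r.
  have gM x : `|lambda * f x| <= `|lambda| * M by rewrite normrM ler_wpM2l.
  have gL x y : `|lambda * f x - lambda * f y| <= `|lambda| * dn d x y.
    by rewrite -mulrBr normrM ler_wpM2l.
  have := resampling_bound dP hsep hC gM gL prodP (normr_ge0 _) halpha_meas halpha_lb s1 rkap.
  rewrite (EFin_mean nu (bounded_measurableZ lambda bf)) (meanZ P lambda bf).
  by rewrite EFinD EFinM (EFin_mean P bf) real_normK ?num_real.
have S13 : S1 -> S3.
  move=> s1 n n0 P prodP lambda f fM fL.
  apply: ge_ereal_sup => _ [nu [kap [hkap ->]]].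
  exact: resampling_dual s1 prodP (resampling_others dP hsep hkap) fM fL.
have S13' : S1 -> S3'.
  move=> s1 n n0 P prodP lambda f fM fL.
  apply: ge_ereal_sup => _ [nu [kh [hkh ->]]].
  exact: resampling_dual s1 prodP (resampling_seq dP hsep hkh) fM fL.
have S32 : S3 -> S2.
  move=> s3 n n0 P prodP nu kap hkap.
  apply: (transport_bound dP hsep prodP hC imu) => lambda f fM fL.
  apply: le_trans (s3 n n0 P prodP lambda f fM fL).
  by apply: ereal_sup_ubound; exists nu, kap.
have S32' : S3' -> S2'.
  move=> s3 n n0 P prodP nu kh hkh.
  apply: (transport_bound dP hsep prodP hC imu) => lambda f fM fL.
  apply: le_trans (s3 n n0 P prodP lambda f fM fL).
  by apply: ereal_sup_ubound; exists nu, kh.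
have const_cost n (nu : probability (Bor d) R) (Q : probability (BorN d n) R) a :
    alpha nu = a%:E -> (\int[Q]_x (\sum_(k < n) alpha nu) = (n%:R * a)%:E)%E.
  move=> ->; rewrite sumEFin sumr_const card_ord integral_cst//= probability_setT mule1.
  by rewrite mulr_natl.
(* Only finite values of [alpha nu] matter: [+oo] is trivial and [-oo] is excluded by the lower
   bound. For product measures all conditional laws may be taken equal to [nu], with total cost
   [n * alpha nu]. *)
have reduce : (forall (nu : probability (Bor d) R) a, alpha nu = a%:E ->
    forall n (P Q : probability (BorN d n) R), (0 < n)%N ->
    is_prod_meas mu P -> is_prod_meas nu Q ->
    (Wpow (T := BorN d n) (@dn R E d n) 1 P Q * Wpow (T := BorN d n) (@dn R E d n) 1 P Q <=
     C%:E * (n%:R * a)%:E)%E) -> S1.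
  move=> conc nu; have [m lb] := halpha_lb; have := lb nu.
  case alphaE : (alpha nu) => [a| |]// _; last by rewrite gt0_muley ?leey.
  exact: (transport_of_concentration dP hsep imu (conc nu a alphaE)).
have S21 : S2 -> S1.
  move=> s2; apply: reduce => nu a alphaE n P Q n0 prodP prodQ.
  rewrite -(const_cost n nu Q a alphaE).
  exact: s2 n n0 P prodP Q _ (cond_others_prod dP hsep prodQ).
have S21' : S2' -> S1.
  move=> s2; apply: reduce => nu a alphaE n P Q n0 prodP prodQ.
  rewrite -(const_cost n nu Q a alphaE).
  exact: s2 n n0 P prodP Q _ (cond_seq_prod dP hsep prodQ).
(* Two cycles close the argument: [S1] to [S3] to [S2] to [S1], and the same with primes. *)
by split; split; tauto.
Qed.
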